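(* Let $(P_i, \mathbf{v}_i, e_i)_{i=1}^{\infty}$ be a sequence of tuples where $P_i\subset\mathbb{R}^2$ is a polygon (not necessarily convex), $\mathbf{v}_i$ is a vertex of $P_i$, and $e_i$ is an edge of $P_i$ not incident to $\mathbf{v}_i$. Suppose there is a constant $c_v>0$, independent of $i$, such that the following hold (for all $i$ where applicable): (A1) $\operatorname{diam}(P_i) = 1$; (A2) $e_i$ lies on the $x$-axis; (A3) $\mathbf{v}_i$ lies on the positive $y$-axis; (A5) $\operatorname{dist}(\mathbf{o}, \mathbf{v}_e) > c_v$ for each endpoint $\mathbf{v}_e$ of $e_i$, where $\mathbf{o}$ is the origin; (A6) $\operatorname{dist}(\mathbf{v}_i, e_i) \rightarrow 0$ as $i\rightarrow \infty$; (A7) $\operatorname{dist}(\mathbf{v}_i, \mathbf{v}_a)> c_v$ for all vertices $\mathbf{v}_a\neq \mathbf{v}_i$ of $P_i$; (A8) $\operatorname{dist}(\mathbf{v}_i, e_a) > c_v$ for all edges $e_a$ of $P_i$ other than $e_i$ and the two edges incident to $\mathbf{v}_i$; (A9) the segment between $\mathbf{v}_i$ and the origin is contained in $P_i$. Then, for the function $u(x,y) = x^2$, $$\lim_{i\rightarrow \infty} \frac{ |u-I_{P_i} u|_{H^1(P_i)} }{ |u|_{H^2(P_i)} } = \infty,$$ where $I_{P_i}u$ is the harmonic-coordinate interpolant of $u$ on $P_i$.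
   Context: A polygon is a simple planar polygon (regarded as a closed region where containment is concerned) with a specified list of vertices; interior angles of $180^\circ$ at vertices are allowed, and each segment between consecutive vertices counts as a separate edge. Sobolev seminorms: $|w|_{H^m(P)}^2 = \int_P \sum_{|\alpha|=m} |D^\alpha w|^2$. Harmonic interpolant: for $u\in H^2(P)$, let $g_u:\partial P\to\mathbb{R}$ be the function that is linear on each edge of $P$ and equals $u$ at each vertex of $P$. Then $I_P u\in H^1(P)$ is the (unique, weak) solution of $\Delta(I_P u)=0$ in $P$, $I_P u = g_u$ on $\partial P$. *)

(* Defs.v *)
From HB Require Import structures.
From mathcomp Require Import all_boot all_order all_algebra.
From mathcomp Require Import all_classical all_reals all_analysis.

Set Implicit Arguments.
Unset Strict Implicit.
Unset Printing Implicit Defensive.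

Import Order.TTheory GRing.Theory Num.Theory.
Import numFieldNormedType.Exports.

Local Open Scope classical_set_scope.
Local Open Scope ring_scope.

(* The norm of the library on [R * R] is the max norm (same topology and same
   bounded sets); distances, lengths and diameters must use [edist2]. *)
Definition edist2 (R : realType) (p q : R * R) : R :=
  Num.sqrt ((p.1 - q.1) ^+ 2 + (p.2 - q.2) ^+ 2).

Definition edist_to (R : realType) (p : R * R) (A : set (R * R)) : R :=
  inf [set edist2 p q | q in A].

(* [sup] is 0 on unbounded sets, so [ediam A = 1] entails boundedness. *)
Definition ediam (R : realType) (A : set (R * R)) : R :=
  sup [set edist2 pq.1 pq.2 | pq in A `*` A].

Definition seg_pt (R : realType) (e : (R * R) * (R * R)) (t : R) : R * R :=
  ((1 - t) * e.1.1 + t * e.2.1, (1 - t) * e.1.2 + t * e.2.2).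

Definition seg (R : realType) (e : (R * R) * (R * R)) : set (R * R) :=
  [set seg_pt e t | t in `[0, 1]].

(* A polygon is given by the cyclic list of its vertices. *)
Definition edges (R : realType) (s : seq (R * R)) : seq ((R * R) * (R * R)) :=
  zip s (rot 1 s).

(* Nonconsecutive edges are disjoint and consecutive edges only meet at their
   common vertex; 180-degree angles at a vertex are not excluded. *)
Definition simple_polygon (R : realType) (s : seq (R * R)) : Prop :=
  [/\ (2 < size s)%N, uniq s &
      forall e f, e \in edges s -> f \in edges s -> e != f ->
        seg e `&` seg f `<=`
        [set p | p \in [:: e.1; e.2] /\ p \in [:: f.1; f.2]]].

Definition poly_boundary (R : realType) (s : seq (R * R)) : set (R * R) :=
  [set p | exists2 e, e \in edges s & seg e p].

(* The points enclosed by the boundary curve: those of the bounded component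
   of its complement. *)
Definition poly_interior (R : realType) (s : seq (R * R)) : set (R * R) :=
  [set p | ~ poly_boundary s p /\
           bounded_set (connected_component (~` poly_boundary s) p)].

Definition poly_region (R : realType) (s : seq (R * R)) : set (R * R) :=
  poly_interior s `|` poly_boundary s.

Notation leb2 R := (@lebesgue_measure R \x @lebesgue_measure R)%E.

Definition dir (R : realType) (i : bool) : R * R :=
  if i then (0, 1) else (1, 0).

Definition pd (R : realType) (i : bool) (f : R * R -> R) : R * R -> R :=
  fun p => 'D_(dir R i) f p.

(* D^(a, b) f *)
Definition pdn (R : realType) (a b : nat) (f : R * R -> R) : R * R -> R :=
  iter a (pd false) (iter b (pd true) f).

(* C^infty(R^2): all iterated partial derivatives, in any order, exist and are
   continuous. *)
Definition smooth (R : realType) (f : R * R -> R) : Prop :=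
  forall s : seq bool,
    continuous (foldr (@pd R) f s) /\
    forall i p, derivable (foldr (@pd R) f s) p (dir R i).

(* C_c^infty(O) *)
Definition test_fun (R : realType) (O : set (R * R)) (f : R * R -> R) : Prop :=
  [/\ smooth f, compact (closure [set p | f p != 0]) &
      closure [set p | f p != 0] `<=` O].

Definition loc_integrable2 (R : realType) (O : set (R * R))
    (f : R * R -> R) : Prop :=
  forall K, compact K -> K `<=` O -> (leb2 R).-integrable K (EFin \o f).

Definition square_integrable (R : realType) (O : set (R * R))
    (f : R * R -> R) : Prop :=
  measurable_fun O f /\ (\int[leb2 R]_(p in O) (f p ^+ 2)%:E < +oo)%E.

Definition is_weak_deriv (R : realType) (O : set (R * R)) (a b : nat)
    (w g : R * R -> R) : Prop :=
  [/\ loc_integrable2 O w, loc_integrable2 O g &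
      forall f, test_fun O f ->
        \int[leb2 R]_(p in O) (w p * pdn a b f p) =
        (-1) ^+ (a + b) * \int[leb2 R]_(p in O) (g p * f p)].

(* The weak derivative D^(a, b) w on O, unique up to a null set; only
   meaningful when it exists. *)
Definition weak_deriv (R : realType) (O : set (R * R)) (a b : nat)
    (w : R * R -> R) : R * R -> R :=
  xget (fun=> 0) [set g | is_weak_deriv O a b w g].

(* w \in H^m(O) *)
Definition sobolev (R : realType) (O : set (R * R)) (m : nat)
    (w : R * R -> R) : Prop :=
  forall a b, (a + b <= m)%N ->
    exists2 g, is_weak_deriv O a b w g & square_integrable O g.

(* |w|_{H^m(O)}^2; the sum ranges over the multi-indices (k, m - k). *)
Definition Hseminorm_sq (R : realType) (O : set (R * R)) (m : nat)
    (w : R * R -> R) : \bar R :=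
  (\int[leb2 R]_(p in O)
     (\sum_(k < m.+1) weak_deriv O k (m - k) w p ^+ 2)%:E)%E.

Definition Hseminorm (R : realType) (O : set (R * R)) (m : nat)
    (w : R * R -> R) : R :=
  Num.sqrt (fine (Hseminorm_sq O m w)).

Definition Hnorm_sq (R : realType) (O : set (R * R)) (m : nat)
    (w : R * R -> R) : \bar R :=
  (\sum_(k < m.+1) Hseminorm_sq O k w)%E.

(* ||h||_{L^2(bd P)}^2 *)
Definition L2_boundary_sq (R : realType) (s : seq (R * R))
    (h : R * R -> R) : \bar R :=
  (\sum_(e <- edges s) (edist2 e.1 e.2)%:E *
     \int[@lebesgue_measure R]_(t in `[0%R, 1%R]) (h (seg_pt e t) ^+ 2)%:E)%E.

(* g is the trace of w on the boundary of P. The trace operator is the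
   continuous extension H^1(P) -> L^2(bd P) of the restriction to the boundary
   of functions smooth up to the boundary, and this is its graph. *)
Definition has_trace (R : realType) (s : seq (R * R))
    (w g : R * R -> R) : Prop :=
  exists f : nat -> R * R -> R,
    [/\ forall k, smooth (f k),
        Hnorm_sq (poly_interior s) 1 (f k \- w) @[k --> \oo] --> 0%E &
        L2_boundary_sq s (f k \- g) @[k --> \oo] --> 0%E].

(* g is linear on each edge and equals u at each vertex. *)
Definition linear_interpolant (R : realType) (s : seq (R * R))
    (u g : R * R -> R) : Prop :=
  forall e, e \in edges s -> forall t, 0 <= t <= 1 ->
    g (seg_pt e t) = (1 - t) * u e.1 + t * u e.2.

Definition weakly_harmonic (R : realType) (O : set (R * R))
    (w : R * R -> R) : Prop :=
  forall f, test_fun O f ->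
    \int[leb2 R]_(p in O)
      (weak_deriv O 1 0 w p * pd false f p +
       weak_deriv O 0 1 w p * pd true f p) = 0.

(* w is (a representative of) the harmonic interpolant of u on P. *)
Definition harmonic_interpolant (R : realType) (s : seq (R * R))
    (u w : R * R -> R) : Prop :=
  [/\ sobolev (poly_interior s) 1 w,
      weakly_harmonic (poly_interior s) w &
      exists2 g, linear_interpolant s u g & has_trace s w g].

(* Main.v *)
(* Write h for the height of the vertex v above the edge e. Let f be a smooth
   function approximating I_P u in H^1 with trace close to the piecewise linear
   g_u, and let phi = u - f. For h < r < rho walk along the upper half of the
   boundary of the square [-r, r]^2, from the point (r, 0) of e until the first
   time the boundary of P is met again; this happens on an edge incident to v.
   At the start phi is close to x^2 - g_u <= - cv^2 / 2, since both endpoints of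
   e are at distance more than cv from the origin, and at the end phi is at least
   - r up to the trace error. Hence phi changes by an amount c > 0 along a path of
   length at most 4r inside P, and the integral of |grad phi|^2 over the path is
   at least c^2 / (4r). By Tonelli, integrating over r gives
     |u - I_P u|_{H^1}^2 >= c' (log rho - log h)
   in the limit f -> I_P u, whereas |u|_{H^2}^2 = 4 |P| <= 16. Squares are used
   instead of circles so that Tonelli applies in Cartesian coordinates. *)
Require Import Defs.
From mathcomp Require Import all_boot all_order all_algebra.
From mathcomp Require Import all_classical all_reals all_analysis.
From mathcomp Require Import measurable_realfun ring lra.
Set Implicit Arguments.
Unset Strict Implicit.
Unset Printing Implicit Defensive.
Import Order.TTheory GRing.Theory Num.Theory.
Import numFieldNormedType.Exports.
Local Open Scope classical_set_scope.
Local Open Scope ring_scope.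

(** * Smooth bump functions on the line *)

(** The data on I_P u are weak: its gradient is a representative picked by [xget], and its trace is
    only an L^2 limit. The energy becomes computable once weak derivatives are known to be unique up
    to null sets; this is the fundamental lemma, whose test functions are products of one-variable
    bumps. The trace error cannot be bounded at the two ends of a single arc, but it can on average
    over r: passing from the radius to the parameter of an edge has a Jacobian at most the length of
    the edge, so the squared end errors integrate to at most a multiple of the L^2 trace error. They
    enter with a factor 1 / r, which is unbounded as h tends to 0. The order of the limits is
    therefore forced: f tends to I_P u with the polygon fixed, and only then does i tend to
    infinity. *)

Definition C1_deriv (R : realType) (f g : R -> R) := forall x : R, is_derive x (1 : R) f (g x).

Fixpoint Ck (R : realType) (n : nat) (f : R -> R) : Prop :=
  if n is m.+1 then exists g : R -> R, C1_deriv f g /\ Ck m g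
  else continuous f.

Lemma Ck_continuous (R : realType) n (f : R -> R) : Ck n f -> continuous f.
Proof.
case: n => [//|n [g [fg _]]] x.
by apply/differentiable_continuous/derivable1_diffP; exact: (@ex_derive _ _ _ _ _ _ _ (fg x)).
Qed.

Lemma CkW (R : realType) n (f : R -> R) : Ck n.+1 f -> Ck n f.
Proof.
elim: n f => [|n IH] f; first exact: Ck_continuous.
by move=> [g [fg cg]]; exists g; split => //; exact: IH.
Qed.

Lemma CkD (R : realType) n (f g : R -> R) : Ck n f -> Ck n g -> Ck n (f \+ g).
Proof.
elim: n f g => [|n IH] f g /=; first by move=> cf cg x; exact: (cvgD (cf x) (cg x)).
move=> [f' [ff' cf']] [g' [gg' cg']]; exists (f' \+ g'); split; last exact: IH.
by move=> x; apply: is_deriveD.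
Qed.

Lemma CkM (R : realType) n (f g : R -> R) : Ck n f -> Ck n g -> Ck n (f \* g).
Proof.
elim: n f g => [|n IH] f g; first by move=> cf cg x; exact: (cvgM (cf x) (cg x)).
move=> cf cg; have cf0 := CkW cf; have cg0 := CkW cg.
move: cf cg => [f' [ff' cf']] [g' [gg' cg']].
exists ((f \* g') \+ (g \* f')); split; last by apply: CkD; exact: IH.
by move=> x; apply: is_deriveM.
Qed.

Lemma CkZ (R : realType) n (c : R) (f : R -> R) :
  Ck n f -> Ck n (fun x => c * f x).
Proof.
elim: n f => [|n IH] f /=; first by move=> cf x; exact: cvgMr (cf x).
move=> [f' [ff' cf']]; exists (fun x => c * f' x); split; last exact: IH.
by move=> x; exact: is_deriveZ.
Qed.

Lemma Ck_affine (R : realType) n (c d : R) (f : R -> R) :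
  Ck n f -> Ck n (fun x => f (c * x + d)).
Proof.
have aff (x : R) : is_derive x 1 (fun x => c * x + d) c.
  have := is_deriveD (is_deriveZ c (is_derive_id x (1 : R)))
                     (is_derive_cst (d : R) x (1 : R)).
  by rewrite addr0 /GRing.scale/= mulr1.
elim: n f => [|n IH] f.
  move=> cf x; apply: (@continuous_comp _ _ _ (fun x => c * x + d) f); last exact: cf.
  by apply/differentiable_continuous/derivable1_diffP; exact: (@ex_derive _ _ _ _ _ _ _ (aff x)).
move=> [f' [ff' cf']]; exists (fun x => c * f' (c * x + d)); split.
  move=> x.
  have := @is_derive1_comp _ f (fun x => c * x + d) x _ _ (ff' _) (aff x).
  by rewrite mulrC.
by apply: CkZ; exact: IH.
Qed.

(* The family is stable under differentiation: flat_n' = flat_(n+2) - n flat_(n+1). *)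
Definition flat (R : realType) (n : nat) (x : R) : R :=
  if 0 < x then x^-1 ^+ n * expR (- x^-1) else 0.

(** From y / (n + 1) <= exp (y / (n + 1)) with y = 1 / x, raised to the power n + 1: the exponential
    beats y^n with one factor x to spare, and that factor gives the limit 0 at the origin. *)
Lemma flat_le (R : realType) n (x : R) : 0 <= flat n x <= n.+1%:R ^+ n.+1 * `|x|.
Proof.
rewrite /flat; case: ifPn => x0; last by rewrite lexx /= mulr_ge0// exprn_ge0.
have xv0 : 0 < x^-1 by rewrite invr_gt0.
apply/andP; split; first by rewrite mulr_ge0 ?expR_ge0// exprn_ge0// ltW.
rewrite gtr0_norm// expRN ler_pdivrMr ?expR_gt0//.
have e1 : x^-1 / n.+1%:R <= expR (x^-1 / n.+1%:R).
  by apply: le_trans (expR_ge1Dx _); rewrite lerDr.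
have e2 : (x^-1 / n.+1%:R) ^+ n.+1 <= expR x^-1.
  have -> : expR x^-1 = expR (x^-1 / n.+1%:R) ^+ n.+1.
    by rewrite -expRM_natr -mulrA mulVf ?mulr1// pnatr_eq0.
  by apply: lerXn2r; rewrite ?nnegrE ?expR_ge0// divr_ge0// ltW.
apply: (@le_trans _ _ (n.+1%:R ^+ n.+1 * x * (x^-1 / n.+1%:R) ^+ n.+1)); last first.
  by rewrite ler_wpM2l// mulr_ge0 ?exprn_ge0// ltW.
rewrite [leRHS](_ : _ = x^-1 ^+ n)//.
rewrite expr_div_n mulrCA mulrAC mulrA divff ?mul1r; last by rewrite expf_neq0// pnatr_eq0.
by rewrite mulr1 exprS mulrAC mulVf ?mul1r// gt_eqF.
Qed.

(** At 0 the difference quotient of [flat n] is [flat n.+1], which [flat_le] sends to 0; elsewhere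
    this is the product and chain rules. *)
Lemma is_derive_flat (R : realType) n (x : R) :
  is_derive x (1 : R) (@flat R n) (flat n.+2 x - n%:R * flat n.+1 x).
Proof.
have [x0|x0|->] := ltgtP x 0.
- apply: (@near_eq_is_derive _ _ _ (cst 0)).
    near=> y; rewrite /flat /cst ifF//; apply/negbTE; rewrite -leNgt ltW//; near: y.
    exact: lt_nbhsl.
  have f0 m : flat m x = 0 by rewrite /flat lt_gtF.
  by rewrite !f0 mulr0 subr0; exact: is_derive_cst.
- apply: (@near_eq_is_derive R R R (fun x : R => x^-1 ^+ n * expR (- x^-1) : R)).
    near=> y; rewrite /flat ifT//; near: y.
    exact: lt_nbhsr.
  rewrite /flat x0.
  have xN0 : x != 0 by rewrite gt_eqF.
  have d1 : is_derive x (1 : R) (fun x : R => x^-1) (- x ^- 2).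
    have := @is_deriveV _ id x 1 1 xN0 (is_derive_id _ _).
    by rewrite /GRing.scale/= mulr1.
  have d2 := is_deriveX n d1.
  have d3 : is_derive x (1 : R) (fun x : R => expR (- x^-1)) (expR (- x^-1) * x ^- 2).
    have := @is_derive1_comp _ expR (fun x => - x^-1) x _ _ (is_derive_expR _) (is_deriveN d1).
    by rewrite opprK.
  have := is_deriveM d2 d3.
  rewrite exprfctE mulrfctE => /is_derive_eq; apply; rewrite /GRing.scale/=.
  case: n {d2} => [|n]; first by rewrite !mul0r !mulr0 subr0 addr0 expr0 mul1r mulrC !exprVn.
  rewrite /= -!exprVn !exprS expr0 mulr1; ring.
- have f0 m : flat m (0 : R) = 0 by rewrite /flat ltxx.
  rewrite !f0 mulr0 subr0.
  have cv0 : h^-1 *: (flat n (h *: (1 : R) + 0) - flat n 0) @[h --> (0 : R)^'] --> (0 : R).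
    apply/cvgrPdist_le => e e0.
    pose C : R := n.+2%:R ^+ n.+2.
    have C0 : 0 < C by rewrite exprn_gt0.
    near=> h.
    have hN0 : h != 0 by near: h; exact: nbhs_dnbhs_neq.
    rewrite sub0r normrN f0 subr0 addr0 /GRing.scale/= mulr1.
    apply: (@le_trans _ _ (C * `|h|)).
      have /andP[fge0 fle] := flat_le n.+1 h.
      have -> : h^-1 * flat n h = flat n.+1 h.
        rewrite /flat; case: ifPn => _; last by rewrite mulr0.
        by rewrite exprS mulrA.
      by rewrite ger0_norm.
    rewrite mulrC -ler_pdivlMr//.
    near: h; have eC : 0 < e / C by exact: divr_gt0.
    first [exact: (dnbhs0_le eC) | exact: (@dnbhs0_le _ R^o _ eC) | exact: (nbhs_dnbhs (@nbhs0_le _ R^o _ eC))].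
  apply: DeriveDef; first by apply/cvg_ex; exists 0.
  exact/cvg_lim.
Unshelve. all: by end_near. Qed.

Lemma Ck_flat (R : realType) m n : Ck m (@flat R n).
Proof.
elim: m n => [|m IH] n /=.
  move=> x; apply/differentiable_continuous/derivable1_diffP.
  exact: (@ex_derive _ _ _ _ _ _ _ (is_derive_flat n x)).
exists (fun x => flat n.+2 x + (- n%:R) * flat n.+1 x); split.
  by move=> x; have := is_derive_flat n x; rewrite mulNr.
by apply: CkD; [exact: IH|apply: CkZ; exact: IH].
Qed.

Lemma flat0_itv (R : realType) (x : R) : 0 <= flat 0 x <= 1.
Proof.
rewrite /flat; case: ifPn => x0; rewrite ?lexx ?ler01// expr0 mul1r expR_ge0/=.
by rewrite -expR0 ler_expR oppr_le0 invr_ge0 ltW.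
Qed.

Lemma flat_eq0 (R : realType) (x : R) : (flat 0 x == 0) = (x <= 0).
Proof.
rewrite /flat leNgt; case: ifPn => x0; rewrite ?eqxx//.
by rewrite expr0 mul1r gt_eqF// expR_gt0.
Qed.

Lemma flat0_cvg (R : realType) (x : R) : 0 < x ->
  flat 0 (n.+1%:R * x) @[n --> \oo] --> (1 : R).
Proof.
move=> x0.
have -> : (fun n : nat => flat 0 (n.+1%:R * x)) = (fun n : nat => expR (- (x^-1 * n.+1%:R^-1))).
  by apply/funext => n; rewrite /flat pmulr_rgt0// x0 expr0 mul1r invfM mulrC.
rewrite [X in _ --> X](_ : 1 = expR (- 0)); last by rewrite oppr0 expR0.
have ce := @continuous_expR R (- 0).
have : - (x^-1 / n.+1%:R) @[n --> \oo] --> - (0 : R); last by move=> /cvg_comp; apply.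
apply: cvgN. rewrite -(mulr0 x^-1). apply: cvgMr. exact: cvg_harmonic.
Qed.

(** For k > 0 the set where this is nonzero is ]a, b[, whatever k; as k grows the bump tends to the
    indicator of that interval. *)
Definition bump (R : realType) (k a b x : R) : R :=
  flat 0 (k * (x - a)) * flat 0 (k * (b - x)).

Lemma Ck_bump (R : realType) n (k a b : R) : Ck n (bump k a b).
Proof.
have -> : bump k a b = (fun x => flat 0 (k * x + (- (k * a)))) \*
    (fun x => flat 0 (- k * x + (k * b))).
  by apply/funext => x; rewrite /bump /=; congr (flat 0 _ * flat 0 _); ring.
by apply: CkM; apply: Ck_affine; exact: Ck_flat.
Qed.

Lemma bump_neq0 (R : realType) (k a b x : R) : 0 < k ->
  (bump k a b x != 0) = (a < x < b).
Proof.
move=> k0; rewrite /bump mulf_eq0 !flat_eq0 !pmulr_rle0// !subr_le0.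
by rewrite negb_or -!ltNge.
Qed.

Lemma bump_itv (R : realType) (k a b x : R) : 0 <= bump k a b x <= 1.
Proof.
rewrite /bump; have /andP[? ?] := flat0_itv (k * (x - a)).
have /andP[? ?] := flat0_itv (k * (b - x)).
by rewrite mulr_ge0//= mulr_ile1.
Qed.

Lemma bump_cvg (R : realType) (a b x : R) :
  bump n.+1%:R a b x @[n --> \oo] --> ((a < x < b)%R%:R : R).
Proof.
have [/andP[ax xb]|xab] := boolP (a < x < b).
  by rewrite -[X in _ --> X](mulr1 1); apply: cvgM; apply: flat0_cvg; rewrite subr_gt0.
rewrite (_ : (fun _ => _) = cst 0); first exact: cvg_cst.
by apply/funext => n; apply/eqP; rewrite -[_ == _]negbK bump_neq0.
Qed.

(** * Boxes and Lebesgue measure in the plane *)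

(* The Borel sigma-algebra of the plane as a product, which unification does not
   find from the bare type [R * R]. *)
Notation plane R := (measurableTypeR R * measurableTypeR R)%type.
Notation meas2 R := (@measurable _ (plane R)).
Notation mfun2 R := (@measurable_fun _ _ (plane R) R).

Definition obox (R : realType) (q : (R * R) * (R * R)) : set (R * R) :=
  `]q.1.1, q.1.2[ `*` `]q.2.1, q.2.2[.

Definition cbox (R : realType) (q : (R * R) * (R * R)) : set (R * R) :=
  `[q.1.1, q.1.2] `*` `[q.2.1, q.2.2].

Lemma obox_sub_cbox (R : realType) (q : (R * R) * (R * R)) : obox q `<=` cbox q.
Proof. by move=> p [/= h1 h2]; split => /=; apply: subset_itv_oo_cc. Qed.

Lemma cbox_compact (R : realType) (q : (R * R) * (R * R)) : compact (cbox q).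
Proof. by apply: compact_setX; exact: segment_compact. Qed.

Lemma plane_hausdorff (R : realType) : hausdorff_space (R * R)%type.
Proof. exact: norm_hausdorff. Qed.

Lemma cbox_closed (R : realType) (q : (R * R) * (R * R)) : closed (cbox q).
Proof. by apply: compact_closed; [exact: plane_hausdorff|exact: cbox_compact]. Qed.

Lemma obox_measurable (R : realType) (q : (R * R) * (R * R)) : meas2 R (obox q).
Proof. by apply: measurableX; exact: measurable_itv. Qed.

Lemma cbox_measurable (R : realType) (q : (R * R) * (R * R)) : meas2 R (cbox q).
Proof. by apply: measurableX; exact: measurable_itv. Qed.

Lemma nbhs_obox (R : realType) (A : set (R * R)) (p : R * R) : nbhs p A ->
  exists2 e, 0 < e & forall q : R * R, `|q.1 - p.1| < e -> `|q.2 - p.2| < e -> A q.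
Proof.
move=> [[U V] /= [Up Vp] UV].
move: Up Vp => /nbhs_ballP [e /= e0 eU] /nbhs_ballP [d /= d0 dV].
exists (Num.min e d); first by rewrite lt_min e0.
move=> [x y] /=; rewrite !lt_min => /andP[xe _] /andP[_ yd].
by apply: UV; split => /=; [apply: eU|apply: dV]; rewrite /ball/= distrC.
Qed.

(** Boxes with rational corners suffice. The closed boxes are kept inside A so that bumps on them
    are test functions of A. *)
Lemma open_bigcup_box (R : realType) (A : set (R * R)) : open A ->
  exists2 q : nat -> (R * R) * (R * R),
    forall n, cbox (q n) `<=` A & A = \bigcup_n obox (q n).
Proof.
move=> oA.
pose rq (k : (rat * rat) * (rat * rat)) : (R * R) * (R * R) :=
  ((ratr k.1.1, ratr k.1.2), (ratr k.2.1, ratr k.2.2)).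
(* Reversed bounds make this box empty, a harmless value for codes of no box or of a box that leaves
   A. *)
pose e0 : (R * R) * (R * R) := ((1, 0), (1, 0)).
pose q n := if @unpickle ((rat * rat) * (rat * rat))%type n is Some k then
  if pselect (cbox (rq k) `<=` A) then rq k else e0 else e0.
have c0 : cbox e0 = set0.
  by apply/seteqP; split => // p [/=]; rewrite in_itv /= => /andP[/le_trans h /h]; rewrite ler10.
have qA n : cbox (q n) `<=` A.
  by rewrite /q; case: unpickle => [k|]; [case: (pselect _) => //= _|]; rewrite c0; exact: sub0set.
exists q => //; apply/seteqP; split => [p Ap|p [n _ /obox_sub_cbox]]; last exact: qA.
have [e e_gt0 eA] := nbhs_obox (open_nbhs_nbhs (conj oA Ap)).
have rl (x : R) : exists2 r : rat, x - e < ratr r & ratr r < x.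
  have /rat_in_itvoo[r] : x - e < x by rewrite ltrBlDr ltrDl.
  by rewrite in_itv/= => /andP[? ?]; exists r.
have rr (x : R) : exists2 r : rat, x < ratr r & ratr r < x + e.
  have /rat_in_itvoo[r] : x < x + e by rewrite ltrDl.
  by rewrite in_itv/= => /andP[? ?]; exists r.
have [a a1 a2] := rl p.1; have [b b1 b2] := rr p.1.
have [c c1 c2] := rl p.2; have [d d1 d2] := rr p.2.
pose k : (rat * rat) * (rat * rat) := ((a, b), (c, d)).
have kA : cbox (rq k) `<=` A.
  move=> z [/=]; rewrite !in_itv/= => /andP[z1 z2] /andP[z3 z4].
  by apply: eA; rewrite ltr_distl; apply/andP; split; lra.
exists (pickle k) => //.
have -> : q (pickle k) = rq k by rewrite /q pickleK; case: (pselect _).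
by split; rewrite /= in_itv/= ?a2 ?c2.
Qed.

Lemma open_measurable2 (R : realType) (A : set (R * R)) : open A -> meas2 R A.
Proof.
move=> /open_bigcup_box [q _ ->]; apply: bigcupT_measurable => n; exact: obox_measurable.
Qed.

Lemma closed_measurable2 (R : realType) (A : set (R * R)) : closed A -> meas2 R A.
Proof.
by move=> cA; rewrite -(setCK A); apply: measurableC; apply: open_measurable2; exact: closed_openC.
Qed.

Lemma compact_measurable2 (R : realType) (A : set (R * R)) : compact A -> meas2 R A.
Proof. by move=> /(compact_closed (@plane_hausdorff R)); exact: closed_measurable2. Qed.

Lemma continuous_measurable2 (R : realType) (f : R * R -> R) (D : set (R * R)) :
  continuous f -> meas2 R D -> mfun2 R D f.
Proof.
move=> cf mD; apply: (@measurable_funS _ _ _ _ setT) => //.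
apply: (measurability _ (RGenOpens.measurableE R)).
move=> _ [_ [a [b ->]] <-]; rewrite setTI; apply: open_measurable2.
by move/continuousP: cf; apply; exact: itv_open.
Qed.

Lemma leb2_box (R : realType) (i j : interval R) :
  leb2 R ([set` i] `*` [set` j]) = (lebesgue_measure [set` i] * lebesgue_measure [set` j])%E.
Proof. by rewrite product_measure1E//; exact: measurable_itv. Qed.

Lemma leb2_cbox (R : realType) (a b c d : R) : a <= b -> c <= d ->
  leb2 R (cbox ((a, b), (c, d))) = ((b - a) * (d - c))%:E.
Proof.
move=> ab cd; rewrite leb2_box !lebesgue_measure_itv /= !lte_fin.
move: ab cd; rewrite !le_eqVlt => /orP[/eqP ->|ab] /orP[/eqP ->|cd];
  by rewrite ?ltxx ?ab ?cd ?subrr ?mule0 ?mul0e ?mulr0 ?mul0r // EFinM !EFinB.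
Qed.

Lemma leb2_obox (R : realType) (a b c d : R) : a <= b -> c <= d ->
  leb2 R (obox ((a, b), (c, d))) = ((b - a) * (d - c))%:E.
Proof.
move=> ab cd; rewrite leb2_box !lebesgue_measure_itv /= !lte_fin.
move: ab cd; rewrite !le_eqVlt => /orP[/eqP ->|ab] /orP[/eqP ->|cd];
  by rewrite ?ltxx ?ab ?cd ?subrr ?mule0 ?mul0e ?mulr0 ?mul0r // EFinM !EFinB.
Qed.

Lemma leb2_cbox_lty (R : realType) (q : (R * R) * (R * R)) : (leb2 R (cbox q) < +oo)%E.
Proof.
rewrite leb2_box !lebesgue_measure_itv /=.
by case: ifPn; case: ifPn => _ _; rewrite ?mul0e ?mule0 ?ltry // -!EFinB -EFinM ltry.
Qed.

Lemma compact_cbox (R : realType) (K : set (R * R)) : compact K ->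
  exists2 M : R, 0 < M & K `<=` cbox ((- M, M), (- M, M)).
Proof.
move=> /compact_bounded [M [_ hM]]; exists (`|M| + 1); first by rewrite ltr_wpDl.
move=> p /(hM (`|M| + 1)); rewrite ltr_pwDr ?ler_norm//= => /(_ isT).
rewrite prod_normE ge_max => /andP[h1 h2].
by split => /=; rewrite in_itv/= -ler_norml.
Qed.

Lemma compact_leb2_lty (R : realType) (K : set (R * R)) : compact K -> (leb2 R K < +oo)%E.
Proof.
move=> cK; have [M _ KM] := compact_cbox cK.
apply: le_lt_trans (leb2_cbox_lty ((- M, M), (- M, M))).
by apply: le_measure => //; rewrite inE; [exact: compact_measurable2|exact: cbox_measurable].
Qed.

Lemma continuous_integrable2 (R : realType) (f : R * R -> R) (K D : set (R * R)) :
  continuous f -> compact K -> D `<=` K -> meas2 R D ->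
  (leb2 R).-integrable D (EFin \o f).
Proof.
move=> cf cK DK mD; apply: (@integrableS _ (plane R) R (leb2 R) K) => //; first exact: compact_measurable2.
apply: measurable_bounded_integrable.
- exact: compact_measurable2.
- exact: compact_leb2_lty.
- exact: continuous_measurable2 (compact_measurable2 cK).
- have /compact_bounded[M [_ mrt]] := continuous_compact (continuous_subspaceT cf) cK.
  by exists M; split; rewrite ?num_real // => y yM p Kp; apply: mrt => //; exists p.
Qed.

(** * Partial derivatives along coordinate lines *)

Definition coordOf (R : realType) (i : bool) (p : R * R) : R := if i then p.2 else p.1.

(** The parameter is the moving coordinate itself, not the displacement from p, so all points of one
    line share the same function of one variable. *)
Definition lineOf (R : realType) (i : bool) (p : R * R) (t : R) : R * R :=
  if i then (p.1, t) else (t, p.2).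

Lemma is_derive_line (R : realType) i (p : R * R) (f : R * R -> R) (d : R) :
  is_derive (coordOf i p) (1 : R) (f \o lineOf i p) d <-> is_derive p (dir R i) f d.
Proof.
have E : (fun h : R => h^-1 *: (((f \o lineOf i p) \o shift (coordOf i p)) (h *: (1 : R)) -
      (f \o lineOf i p) (coordOf i p))) =
    (fun h : R => h^-1 *: ((f \o shift p) (h *: dir R i) - f p)).
  apply/funext => h; case: p => x y; case: i; rewrite /= /shift /dir /=;
  congr (_ *: (f _ - f _)); congr pair; rewrite /GRing.scale/=; ring.
by split=> -[h1 h2]; apply: DeriveDef; move: h1 h2; rewrite /derivable /derive E.
Qed.

Lemma pd_is_derive (R : realType) i (p : R * R) (f : R * R -> R) :
  derivable f p (dir R i) ->
  is_derive (coordOf i p) (1 : R) (f \o lineOf i p) (pd i f p).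
Proof. by move=> df; apply/is_derive_line; apply: DeriveDef. Qed.

Definition C1 (R : realType) (f : R * R -> R) : Prop :=
  continuous f /\ forall i, continuous (pd i f) /\ forall p, derivable f p (dir R i).

Lemma smooth_C1 (R : realType) (f : R * R -> R) : smooth f -> C1 f.
Proof.
move=> sf; split; first by have [] := sf [::].
by move=> i; split; [have [] := sf [:: i]|have [_ h] := sf [::]; exact: h].
Qed.

Lemma smooth_pd (R : realType) i (f : R * R -> R) : smooth f -> smooth (pd i f).
Proof. by move=> sf s; have := sf (rcons s i); rewrite foldr_rcons. Qed.

Lemma C1_is_derive (R : realType) i p (f : R * R -> R) : C1 f ->
  is_derive p (dir R i) f (pd i f p).
Proof. by move=> [_ /(_ i)[_ h]]; apply: DeriveDef. Qed.

Lemma is_derive_pd (R : realType) i p (f : R * R -> R) d :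
  is_derive p (dir R i) f d -> pd i f p = d.
Proof. by move=> [_ <-]. Qed.

Lemma C1_of_partials (R : realType) (f : R * R -> R) (g : bool -> R * R -> R) :
  continuous f -> (forall i, continuous (g i)) ->
  (forall i p, is_derive p (dir R i) f (g i p)) ->
  C1 f /\ forall i, pd i f = g i.
Proof.
move=> cf cg dg; have pdE i : pd i f = g i by apply/funext => p; exact: is_derive_pd.
by split=> //; split=> // i; rewrite pdE; split=> // p; have [] := dg i p.
Qed.

Lemma C1M (R : realType) (f g : R * R -> R) : C1 f -> C1 g ->
  C1 (f \* g) /\ forall i, pd i (f \* g) = (f \* pd i g) \+ (g \* pd i f).
Proof.
move=> hf hg; have [cf df] := hf; have [cg dg] := hg.
apply: C1_of_partials.
- by move=> p; exact: (cvgM (cf p) (cg p)).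
- move=> i p; have [cfi _] := df i; have [cgi _] := dg i.
  by apply: cvgD; [exact: (cvgM (cf p) (cgi p))|exact: (cvgM (cg p) (cfi p))].
- by move=> i p; apply: is_deriveM; exact: C1_is_derive.
Qed.

Lemma C1B (R : realType) (f g : R * R -> R) : C1 f -> C1 g ->
  C1 (f \- g) /\ forall i, pd i (f \- g) = pd i f \- pd i g.
Proof.
move=> hf hg; have [cf df] := hf; have [cg dg] := hg.
apply: C1_of_partials.
- by move=> p; exact: (cvgB (cf p) (cg p)).
- move=> i p; have [cfi _] := df i; have [cgi _] := dg i.
  exact: (cvgB (cfi p) (cgi p)).
- by move=> i p; apply: is_deriveB; exact: C1_is_derive.
Qed.

Lemma FTC_C1 (R : realType) (f f' : R -> R) (a b : R) : a <= b ->
  (forall x, is_derive x (1 : R) f (f' x)) -> continuous f' ->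
  (\int[lebesgue_measure]_(x in `[a, b]) (f' x)%:E = (f b - f a)%:E)%E.
Proof.
rewrite le_eqVlt => /predU1P[->|ab] df cf'.
  by rewrite set_itv1 integral_set1 subrr.
have cf : continuous f.
  move=> x; apply/differentiable_continuous/derivable1_diffP.
  exact: (@ex_derive _ _ _ _ _ _ _ (df x)).
rewrite EFinB; apply: continuous_FTC2 => //.
- exact: continuous_subspaceT.
- split => [x _||].
  + exact: (@ex_derive _ _ _ _ _ _ _ (df x)).
  + exact/cvg_at_right_filter/cf.
  + exact/cvg_at_left_filter/cf.
- by move=> x _; rewrite derive1E; exact: (@derive_val _ _ _ _ _ _ _ (df x)).
Qed.

Lemma continuous_pair (R : realType) (f g : R -> R) :
  continuous f -> continuous g -> continuous (fun t => (f t, g t)).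
Proof.
move=> cf cg t; rewrite /continuous_at.
by apply: (cvg_pair (cf t) (cg t)).
Qed.

Lemma lineOf_continuous (R : realType) i (p : R * R) : continuous (lineOf i p).
Proof.
case: i; first by apply: (@continuous_pair R (cst p.1) id) => x; [exact: cvg_cst|exact: cvg_id].
by apply: (@continuous_pair R id (cst p.2)) => x; [exact: cvg_id|exact: cvg_cst].
Qed.

Lemma C1_line (R : realType) i (p : R * R) (f : R * R -> R) : C1 f ->
  (forall t, is_derive t (1 : R) (f \o lineOf i p) (pd i f (lineOf i p t))) /\
  continuous (fun t => pd i f (lineOf i p t)).
Proof.
move=> hf; split => t; last first.
  apply: continuous_comp; first exact: lineOf_continuous.
  by have [_ /(_ i)[h _]] := hf; exact: h.
have [_ /(_ i)[_ h]] := hf; have := pd_is_derive (h (lineOf i p t)).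
by case: i {h} => /=.
Qed.

Lemma FTC_line (R : realType) i (p : R * R) (f : R * R -> R) (a b : R) : a <= b -> C1 f ->
  (\int[lebesgue_measure]_(t in `[a, b]) (pd i f (lineOf i p t))%:E =
   (f (lineOf i p b) - f (lineOf i p a))%:E)%E.
Proof. by move=> ab hf; have [h1 h2] := C1_line i p hf; rewrite (FTC_C1 ab h1 h2). Qed.

(** On each line in direction [dir R i] the derivative integrates to the difference of the values of
    f at [M] and [- M], both 0 because the open box excludes its sides. Fubini is used in the order
    that puts this direction inside. *)
Lemma integral_pd_compact (R : realType) i (f : R * R -> R) (M : R) : 0 < M -> C1 f ->
  (forall p, ~ obox ((- M, M), (- M, M)) p -> f p = 0) ->
  (forall p, ~ cbox ((- M, M), (- M, M)) p -> pd i f p = 0) ->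
  (\int[leb2 R]_p (pd i f p)%:E = 0)%E.
Proof.
move=> M0 hf f0 df0.
set K := cbox ((- M, M), (- M, M)) in df0.
have ci : continuous (pd i f) by have [_ /(_ i)[]] := hf.
have intf : (leb2 R).-integrable setT (EFin \o pd i f).
  have := continuous_integrable2 ci (@cbox_compact _ _) (@subset_refl _ K) (cbox_measurable _).
  move=> /integrable_mkcond; rewrite restrict_EFin.
  move=> /(_ (cbox_measurable _)).
  suff -> : (pd i f \_ K) = pd i f by [].
  by apply/funext => p; rewrite patchE; case: ifPn => // /negP; rewrite inE => /df0.
have MM : - M <= M by rewrite ge0_cp ?ltW.
have Z (p : R * R) : (\int[lebesgue_measure]_t (pd i f (lineOf i p t))%:E = 0)%E.
  transitivity (\int[lebesgue_measure]_(t in `[(- M)%R, M]) (pd i f (lineOf i p t))%:E)%E.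
    rewrite [RHS]integral_mkcond; apply: eq_integral => t _.
    rewrite patchE; case: ifPn => // /negP; rewrite inE /= => tM.
    by rewrite df0// => -[]; case: i {df0 ci intf} => /=.
  rewrite FTC_line// !f0 ?subrr//.
    by move=> []; case: i {df0 ci intf} => /=; rewrite !in_itv /= ltxx ?andbF.
  by move=> []; case: i {df0 ci intf} => /=; rewrite !in_itv /= ltxx ?andbF.
case: i df0 ci intf Z => df0 ci intf Z.
  rewrite -(integral12_prod_meas1 intf) /fubini_F /=.
  by rewrite integral0_eq// => x _; exact: (Z (x, 0)).
rewrite -(integral21_prod_meas1 intf) /fubini_G /=.
by rewrite integral0_eq// => x _; exact: (Z (0, x)).
Qed.

(** * The fundamental lemma of the calculus of variations *)

Definition Coo (R : realType) (f : R -> R) := forall n, Ck n f.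

(** Each order supplies its own derivative; uniqueness of derivatives identifies them all with the
    first one. *)
Lemma Coo_deriv (R : realType) (f : R -> R) : Coo f ->
  exists2 g, C1_deriv f g & Coo g.
Proof.
move=> cf; have [g [fg _]] := cf 1%N.
exists g => // n; have [g' [fg' cg']] := cf n.+1.
suff -> : g = g' by [].
apply/funext => x; rewrite -(@derive_val _ _ _ _ _ _ _ (fg x)).
by rewrite (@derive_val _ _ _ _ _ _ _ (fg' x)).
Qed.

Definition tensor (R : realType) (f g : R -> R) (p : R * R) : R := f p.1 * g p.2.

Lemma tensor_continuous (R : realType) (f g : R -> R) :
  continuous f -> continuous g -> continuous (tensor f g).
Proof.
move=> cf cg p; apply: cvgM.
  by apply: (@continuous_comp _ _ _ fst f); [exact: cvg_fst|exact: cf].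
by apply: (@continuous_comp _ _ _ snd g); [exact: cvg_snd|exact: cg].
Qed.

Lemma tensor_is_derive (R : realType) (f g f' g' : R -> R) i p :
  C1_deriv f f' -> C1_deriv g g' ->
  is_derive p (dir R i) (tensor f g) (if i then tensor f g' p else tensor f' g p).
Proof.
move=> ff' gg'; apply/is_derive_line; case: i => /=.
  exact: (is_deriveZ (f p.1) (gg' p.2)).
have := is_deriveZ (g p.2) (ff' p.1); rewrite /GRing.scale/=.
have -> : (g p.2 \*: f) = (tensor f g \o lineOf false p).
  by apply/funext => t; rewrite /tensor /= mulrC.
by rewrite /tensor mulrC.
Qed.

(** Tensors are stable under [pd], which differentiates one factor, so every iterated partial
    derivative is again a tensor of [Coo] factors. *)
Lemma tensor_smooth (R : realType) (f g : R -> R) : Coo f -> Coo g -> smooth (tensor f g).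
Proof.
move=> cf cg s.
suff [f1 [g1 [cf1 cg1 ->]]] : exists f1 g1, [/\ Coo f1, Coo g1 &
    foldr (@pd R) (tensor f g) s = tensor f1 g1].
  split; first by apply: tensor_continuous; [exact: (Ck_continuous (cf1 0%N))|exact: (Ck_continuous (cg1 0%N))].
  have [f2 f12 _] := Coo_deriv cf1; have [g2 g12 _] := Coo_deriv cg1.
  by move=> i p; have [] := tensor_is_derive i p f12 g12.
elim: s => [|i s [f1 [g1 [cf1 cg1 IH]]]]; first by exists f, g.
have [f2 f12 cf2] := Coo_deriv cf1; have [g2 g12 cg2] := Coo_deriv cg1.
exists (if i then f1 else f2), (if i then g2 else g1); split.
- by case: i.
- by case: i.
- rewrite /= IH; apply/funext => p; rewrite (is_derive_pd (tensor_is_derive i p f12 g12)).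
  by case: i.
Qed.

Definition bump2 (R : realType) (k : R) (q : (R * R) * (R * R)) : R * R -> R :=
  tensor (bump k q.1.1 q.1.2) (bump k q.2.1 q.2.2).

Lemma bump2_neq0 (R : realType) (k : R) q p : 0 < k -> (bump2 k q p != 0) = (p \in obox q).
Proof.
move=> k0; rewrite /bump2 /tensor mulf_eq0 negb_or !bump_neq0//.
by apply/idP/idP; rewrite inE /obox /= !in_itv/= => /andP.
Qed.

Lemma bump2_itv (R : realType) (k : R) q p : 0 <= bump2 k q p <= 1.
Proof.
have /andP[? ?] := bump_itv k q.1.1 q.1.2 p.1.
have /andP[? ?] := bump_itv k q.2.1 q.2.2 p.2.
by rewrite /bump2 /tensor mulr_ge0//= mulr_ile1.
Qed.

Lemma bump2_cvg (R : realType) q (p : R * R) :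
  bump2 n.+1%:R q p @[n --> \oo] --> (\1_(obox q) p : R).
Proof.
have -> : \1_(obox q) p = (q.1.1 < p.1 < q.1.2)%R%:R * (q.2.1 < p.2 < q.2.2)%R%:R :> R.
  rewrite -natrM mulnb indicE; congr (nat_of_bool _)%:R.
  by apply/idP/idP; rewrite inE /obox /= !in_itv/= => /andP.
exact: cvgM (@bump_cvg R q.1.1 q.1.2 p.1) (@bump_cvg R q.2.1 q.2.2 p.2).
Qed.

Lemma bump2_test (R : realType) (k : R) q (O : set (R * R)) : 0 < k ->
  cbox q `<=` O -> test_fun O (bump2 k q).
Proof.
move=> k0 qO.
have clq : closure [set p | bump2 k q p != 0] `<=` cbox q.
  have : [set p | bump2 k q p != 0] `<=` cbox q.
    move=> p /=; rewrite bump2_neq0// inE; exact: obox_sub_cbox.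
  by move=> /closure_subset; rewrite -(closure_id (cbox q)).1//; exact: cbox_closed.
split; last by apply: subset_trans qO.
- by apply: tensor_smooth => n; exact: Ck_bump.
- by apply: subclosed_compact clq; [exact: closed_closure|exact: cbox_compact].
Qed.

Lemma test_fun_support (R : realType) (O : set (R * R)) (f : R * R -> R) :
  test_fun O f -> exists K, [/\ compact K, K `<=` O & forall p, ~ K p -> f p = 0].
Proof.
move=> [_ cK KO]; exists (closure [set p | f p != 0]); split => // p Kp.
by apply: contra_notP Kp => /eqP ?; exact: subset_closure.
Qed.

(** The complement of K is open, so f vanishes in a neighbourhood of p and not only at p. *)
Lemma pd_support (R : realType) i (K : set (R * R)) (f : R * R -> R) : compact K ->
  (forall p, ~ K p -> f p = 0) -> forall p, ~ K p -> pd i f p = 0.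
Proof.
move=> cK f0 p Kp.
have oK : open (~` K) by apply: closed_openC; apply: compact_closed => //; exact: plane_hausdorff.
rewrite /pd (@near_eq_derive _ _ _ _ (cst 0)).
  exact: (@derive_val _ _ _ _ _ _ _ (is_derive_cst _ _ _)).
have : nbhs p (~` K) by apply: open_nbhs_nbhs.
by apply: filterS => y Ky; rewrite f0.
Qed.

Lemma integral_off_support (R : realType) (K O : set (R * R)) (f : R * R -> R) :
  K `<=` O -> (forall p, ~ K p -> f p = 0) ->
  (\int[leb2 R]_(p in O) (f p)%:E = \int[leb2 R]_(p in K) (f p)%:E)%E.
Proof.
move=> KO f0; rewrite integral_mkcond [RHS]integral_mkcond; apply: eq_integral => p _.
rewrite !patchE; case: ifPn; case: ifPn => //; rewrite ?inE.
- by move=> /negP; rewrite inE => /f0 ->.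
- by move=> /KO ? /negP; rewrite inE.
Qed.

Lemma integrable_off_support (R : realType) (K O : set (R * R)) (f : R * R -> R) :
  meas2 R K -> meas2 R O ->
  K `<=` O -> (forall p, ~ K p -> f p = 0) ->
  (leb2 R).-integrable K (EFin \o f) -> (leb2 R).-integrable O (EFin \o f).
Proof.
move=> mK mO KO f0 /(integrable_mkcond _ mK) h; apply/(integrable_mkcond _ mO).
suff -> : (EFin \o f) \_ O = (EFin \o f) \_ K by [].
apply/funext => p; rewrite !patchE; case: ifPn; case: ifPn => //; rewrite ?inE.
- by move=> /negP; rewrite inE => /f0 /= ->.
- by move=> /KO ? /negP; rewrite inE.
Qed.

Lemma integrable_mul_supp (R : realType) (K O : set (R * R)) (g f : R * R -> R) :
  meas2 R O -> loc_integrable2 O g -> compact K -> K `<=` O -> continuous f ->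
  (forall p, ~ K p -> f p = 0) ->
  (leb2 R).-integrable O (EFin \o (fun p => g p * f p)).
Proof.
move=> mO lg cK KO cf f0.
apply: (@integrable_off_support _ K) => //; first exact: compact_measurable2.
  by move=> p /f0 ->; rewrite mulr0.
have := @integrableMl _ (plane R) R (leb2 R) K (compact_measurable2 cK) _ f (lg K cK KO).
apply; first exact: continuous_measurable2 (compact_measurable2 cK).
have /compact_bounded[M [_ mrt]] := continuous_compact (continuous_subspaceT cf) cK.
by exists M; split; rewrite ?num_real // => y yM p Kp; apply: mrt => //; exists p.
Qed.

Lemma loc_integrable_continuous (R : realType) (O : set (R * R)) (f : R * R -> R) :
  continuous f -> loc_integrable2 O f.
Proof.
move=> cf K cK _; apply: (continuous_integrable2 cf cK) => //; exact: compact_measurable2.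
Qed.

(** The product [w \* f] has compact support, so its partial derivative has integral 0 over the
    plane; the product rule splits that integral. *)
Lemma integration_by_parts2 (R : realType) (O K : set (R * R)) i (w f : R * R -> R) :
  meas2 R O -> compact K -> K `<=` O -> C1 w -> C1 f -> (forall p, ~ K p -> f p = 0) ->
  \int[leb2 R]_(p in O) (w p * pd i f p) = - \int[leb2 R]_(p in O) (pd i w p * f p).
Proof.
move=> mO cK KO hw hf f0; have df0 := pd_support i cK f0.
have [cw /(_ i)[cdw _]] := hw; have [cf /(_ i)[cdf _]] := hf.
have int1 := integrable_mul_supp mO (loc_integrable_continuous cw) cK KO cdf df0.
have int2 := integrable_mul_supp mO (loc_integrable_continuous cdw) cK KO cf f0.
have [hF pdF] := C1M hw hf.
apply/eqP; rewrite -addr_eq0 -RintegralD//; apply/eqP.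
have F0 p : ~ K p -> (w \* f) p = 0 by move=> /f0 /= ->; rewrite mulr0.
have [M M0 KM] := compact_cbox cK.
(* The margin 1 moves K from a closed box into an open one, as [integral_pd_compact] requires. *)
have M10 : 0 < M + 1 by rewrite addr_gt0.
have KM1 : K `<=` obox ((- (M + 1), M + 1), (- (M + 1), M + 1)).
  move=> p /KM [/=]; rewrite !in_itv/= => /andP[a1 a2] /andP[a3 a4].
  by split; rewrite /= in_itv/=; apply/andP; split; lra.
have := @integral_pd_compact R i (w \* f) (M + 1) M10 hF.
move=> /(_ (fun p h => F0 p (fun k => h (KM1 p k)))).
move=> /(_ (fun p h => pd_support i cK F0 (fun k => h (obox_sub_cbox (KM1 p k))))) h.
rewrite /Rintegral.
rewrite -[RHS]/(fine 0) -h; congr fine.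
rewrite pdF.
have E0 p : ~ K p -> w p * pd i f p + pd i w p * f p = 0.
  by move=> Kp; rewrite f0// df0// !mulr0 addr0.
rewrite (integral_off_support KO E0) -(integral_off_support (@subsetT _ K) E0).
by apply: eq_integral => p _; rewrite /= [f p * _]mulrC.
Qed.

(* Pi-lambda: the sets over which the integral vanishes form a Dynkin system. *)
Lemma integral0_dynkin d d' (T : measurableType d) (T' : measurableType d') (R : realType)
    (mu : {measure set T' -> \bar R}) (z : T' -> \bar R) (g : T' -> T)
    (G : set (set T)) (D : set T') :
  mu.-integrable setT z -> measurable_fun setT g -> measurable D ->
  @measurable _ T = <<s G >> -> setI_closed G ->
  (\int[mu]_(x in D) z x = 0)%E ->
  (forall A, G A -> (\int[mu]_(x in D `&` g @^-1` A) z x = 0)%E) ->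
  forall A, measurable A -> (\int[mu]_(x in D `&` g @^-1` A) z x = 0)%E.
Proof.
move=> iz mg mD GE GI zD zG.
have mpre A : measurable A -> measurable (D `&` g @^-1` A).
  by move=> mA; apply: measurableI => //; rewrite -[X in measurable X]setTI; exact: mg.
have izS A : measurable A -> mu.-integrable A z by move=> mA; apply: integrableS iz.
rewrite [X in forall A, X A -> _]GE.
apply: (dynkin_induction GE GI).
- by rewrite preimage_setT setIT.
- exact: zG.
- move=> S mS zS.
  have DE : D = (D `&` g @^-1` S) `|` (D `&` g @^-1` (~` S)).
    by rewrite -setIUr preimage_setC setUv setIT.
  have dj : [disjoint D `&` g @^-1` S & D `&` g @^-1` (~` S)].
    by apply/disj_setPS => x [[_ h] [_ h']]; exact: h'.
  have := zD; rewrite {1}DE (integral_setU mu (mpre _ mS) (mpre _ (measurableC mS)) _ dj).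
    by rewrite zS add0e.
  by rewrite -DE; apply: measurable_int (izS _ mD).
- move=> F mF tF zF.
  rewrite preimage_bigcup setI_bigcupr integral_bigcup//.
  + by rewrite eseries0// => k _ _; exact: zF.
  + apply/trivIsetP => a b _ _ ab; move/trivIsetP : tF => /(_ a b Logic.I Logic.I ab) /seteqP[h _].
    by apply/seteqP; split => // x [[_ h1] [_ h2]]; have := h (g x); apply.
  + by move=> k; exact: mpre.
  + by apply: izS; apply: bigcupT_measurable => k; exact: mpre.
Qed.

Lemma test_integral_fine (R : realType) (O : set (R * R)) (z f : R * R -> R) :
  meas2 R O -> loc_integrable2 O z -> test_fun O f ->
  ((\int[leb2 R]_(p in O) (z p * f p))%:E = \int[leb2 R]_(p in O) (z p * f p)%:E)%E.
Proof.
move=> mO lz tf; have [K [cK KO f0]] := test_fun_support tf.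
have cf : continuous f by case: tf => /smooth_C1 [].
rewrite /Rintegral fineK//; apply: integrable_fin_num => //.
exact: integrable_mul_supp lz cK KO cf f0.
Qed.

Lemma bump2_support (R : realType) (k : R) q (p : R * R) : 0 < k ->
  ~ cbox q p -> bump2 k q p = 0.
Proof.
move=> k0 qp; apply/eqP; rewrite -[_ == _]negbK bump2_neq0//.
by apply/negP; rewrite inE => /obox_sub_cbox.
Qed.

(** Dominated convergence: the bumps tend to the indicator of the open box and their products with z
    are dominated by |z|, integrable on the closed box. *)
Lemma test_box_integral0 (R : realType) (O : set (R * R)) (z : R * R -> R) q :
  meas2 R O -> loc_integrable2 O z ->
  (forall f, test_fun O f -> \int[leb2 R]_(p in O) (z p * f p) = 0) ->
  cbox q `<=` O -> (\int[leb2 R]_(p in obox q) (z p)%:E = 0)%E.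
Proof.
move=> mO lz tz qO.
have iz := lz _ (@cbox_compact _ q) qO.
have mz : mfun2 R (cbox q) z by apply/measurable_EFinP; exact: measurable_int iz.
pose f_ n p := (z p * bump2 n.+1%:R q p)%:E.
pose f p := (z p * \1_(obox q) p)%:E.
have bt n : test_fun O (bump2 n.+1%:R q) by apply: bump2_test.
have cb n : continuous (bump2 (n.+1%:R : R) q) by case: (bt n) => /smooth_C1 [].
have [] := @dominated_convergence _ (plane R) R (leb2 R) (cbox q) (cbox_measurable q) f_ f
  (fun p => `|(z p)%:E|%E).
- move=> n; apply/measurable_EFinP; apply: measurable_funM => //.
  by apply: continuous_measurable2 => //; exact: cbox_measurable.
- apply/measurable_EFinP; apply: measurable_funM => //.
  by apply: measurable_indic; exact: obox_measurable.
- apply: aeW => p _; apply: cvg_EFin; first by near=> n.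
  have h : z p * bump2 n.+1%:R q p @[n --> \oo] --> (z p * \1_(obox q) p : R).
    by apply: cvgM; [exact: cvg_cst|exact: bump2_cvg].
  exact: h.
- exact: integrable_abse iz.
- apply: aeW => p n _; rewrite /f_ abse_EFin lee_fin normrM.
  have /andP[b0 b1] := bump2_itv n.+1%:R q p.
  by rewrite [X in _ * X <= _]ger0_norm// ler_piMr.
move=> _ _.
have f_0 n : (\int[leb2 R]_(p in cbox q) f_ n p = 0)%E.
  rewrite /f_ -(integral_off_support qO).
    by rewrite -test_integral_fine// tz.
  by move=> p /(bump2_support (ltr0Sn R n)) ->; rewrite mulr0.
under eq_fun do rewrite f_0.
move=> /(cvg_unique _ (cvg_cst _))  => ->; last exact: ereal_hausdorff.
rewrite [LHS]integral_mkcond [RHS]integral_mkcond; apply: eq_integral => p _.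
rewrite !patchE /f indicE.
case: ifPn => [/set_mem h|].
  by rewrite mem_set ?mem_set// ?mulr1//; exact: obox_sub_cbox.
by move=> _; rewrite mulr0; case: ifP.
Unshelve. all: by end_near. Qed.

Lemma RGenOpens_setI (R : realType) : setI_closed (@RGenOpens.G R).
Proof.
move=> _ _ [a [b ->]] [c [d ->]]; exists (Num.max a c), (Num.min b d).
apply/seteqP; split => x /=; rewrite !in_itv/= gt_max lt_min.
  by move=> [/andP[-> ->] /andP[-> ->]].
by move=> /andP[/andP[-> ->] /andP[-> ->]].
Qed.

(** The integrals of z over open boxes inside q vanish, and open boxes are closed under
    intersection. Three Dynkin arguments extend this to a measurable first factor, to measurable
    rectangles and to all measurable sets; a function all of whose integrals vanish is 0 almost
    everywhere. *)
Lemma test_ae0_box (R : realType) (O : set (R * R)) (z : R * R -> R) q :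
  meas2 R O -> loc_integrable2 O z ->
  (forall f, test_fun O f -> \int[leb2 R]_(p in O) (z p * f p) = 0) ->
  cbox q `<=` O -> (leb2 R).-negligible (obox q `&` [set p | z p != 0]).
Proof.
move=> mO lz tz qO.
have iq : (leb2 R).-integrable (obox q) (EFin \o z).
  apply: integrableS (lz _ (@cbox_compact _ q) qO); [exact: cbox_measurable|exact: obox_measurable|exact: obox_sub_cbox].
(* Extension by zero makes z integrable on the whole plane, as the Dynkin argument requires. *)
pose z0 : plane R -> \bar R := (EFin \o z) \_ (obox q).
have iz : (leb2 R).-integrable setT z0 by exact: ((integrable_mkcond _ (obox_measurable q)).1 iq).
have zbox (A : set (R * R)) : (\int[leb2 R]_(p in A) z0 p =
    \int[leb2 R]_(p in A `&` obox q) (z p)%:E)%E.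
  by rewrite [RHS]integral_mkcondr.
have z1 x y x' y' : (\int[leb2 R]_(p in `]x, y[ `*` `]x', y'[) z0 p = 0)%E.
  rewrite zbox.
  have -> : (`]x, y[ `*` `]x', y'[) `&` obox q = obox ((Num.max x q.1.1, Num.min y q.1.2),
      (Num.max x' q.2.1, Num.min y' q.2.2)).
    apply/seteqP; split => p; rewrite /obox /= !in_itv/= !gt_max !lt_min.
      by move=> [[/andP[-> ->] /andP[-> ->]] [/andP[-> ->] /andP[-> ->]]].
    by move=> [/andP[/andP[-> ->] /andP[-> ->]] /andP[/andP[-> ->] /andP[-> ->]]].
  apply: (test_box_integral0 mO lz tz); apply: subset_trans qO.
  move=> p; rewrite /cbox /= !in_itv/= !ge_max !le_min.
  by move=> [/andP[/andP[_ ->] /andP[_ ->]] /andP[/andP[_ ->] /andP[_ ->]]].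
have GE := RGenOpens.measurableE R.
have mfst : @measurable_fun _ _ (plane R) (measurableTypeR R) setT fst by exact: measurable_fst.
have msnd : @measurable_fun _ _ (plane R) (measurableTypeR R) setT snd by exact: measurable_snd.
have z2 x' y' (A : set R) : @measurable _ (measurableTypeR R) A ->
    (\int[leb2 R]_(p in A `*` `]x', y'[) z0 p = 0)%E.
  move=> mA.
  have := @integral0_dynkin _ _ (measurableTypeR R) (plane R) R (leb2 R) z0 fst _
    (snd @^-1` `]x', y'[) iz mfst _ GE (@RGenOpens_setI R) _ _ A mA.
  rewrite setIC; apply.
  - by rewrite -[X in measurable X]setTI; apply: msnd => //; exact: measurable_itv.
  (* The whole strip: [z0] lives on q, so the strip may be cut down to the box with the first side
     of q. *)
  - rewrite zbox -(z1 q.1.1 q.1.2 x' y') zbox; congr (integral _ _ _).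
    by apply/seteqP; split => p /= [h1 [h2 h3]]; split => //; case: h1.
  - by move=> _ [x [y ->]]; rewrite setIC; exact: z1.
have z3 (A B : set R) : @measurable _ (measurableTypeR R) A -> @measurable _ (measurableTypeR R) B ->
    (\int[leb2 R]_(p in A `*` B) z0 p = 0)%E.
  move=> mA mB.
  have := @integral0_dynkin _ _ (measurableTypeR R) (plane R) R (leb2 R) z0 snd _
    (fst @^-1` A) iz msnd _ GE (@RGenOpens_setI R) _ _ B mB.
  apply.
  - by rewrite -[X in measurable X]setTI; apply: mfst.
  - rewrite zbox -(z2 q.2.1 q.2.2 A mA) zbox; congr (integral _ _ _).
    by apply/seteqP; split => p /= [h1 [h2 h3]]; split => //; case: h1.
  - by move=> _ [x [y ->]]; exact: z2.
have z4 (A : set (R * R)) : meas2 R A -> (\int[leb2 R]_(p in A) z0 p = 0)%E.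
  move=> mA.
  have := @integral0_dynkin _ _ (plane R) (plane R) R (leb2 R) z0 id _
    setT iz _ _ (@measurable_prod_measurableType _ _ (measurableTypeR R) (measurableTypeR R)) _ _ _ A mA.
  rewrite setTI; apply => //.
  - move=> _ _ [A1 mA1 [A2 mA2 <-]] [B1 mB1 [B2 mB2 <-]].
    exists (A1 `&` B1); first exact: measurableI.
    exists (A2 `&` B2); first exact: measurableI.
    by rewrite setXI.
  - by rewrite -setXTT; apply: z3.
  - by move=> _ [A1 mA1 [A2 mA2 <-]]; rewrite setTI; exact: z3.
have ae0 : ae_eq (leb2 R) setT (cst 0%E : plane R -> \bar R) z0.
  apply: ae_eq_sym; apply: (integral_ae_eq measurableT iz (measurable_cst _)) => E _ mE.
  by rewrite integral0 z4.
case: ae0.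
move=> N [mN N0 zN]; exists N; split => //.
apply: subset_trans zN => p [qp /= zp] /(_ Logic.I) /= /esym /eqP.
by rewrite /z0 patchE mem_set//= eqe; exact/negP.
Qed.

(** Countably many boxes cover O, so the exceptional null sets of the boxes add up to a null set. *)
Lemma fundamental_lemma (R : realType) (O : set (R * R)) (z : R * R -> R) :
  open O -> loc_integrable2 O z ->
  (forall f, test_fun O f -> \int[leb2 R]_(p in O) (z p * f p) = 0) ->
  {ae leb2 R, forall p, O p -> z p = 0}.
Proof.
move=> oO lz tz; have [q qO OE] := open_bigcup_box oO.
have : (leb2 R).-negligible (\bigcup_n (obox (q n) `&` [set p | z p != 0])).
  apply: negligible_bigcup => n; apply: (test_ae0_box (O := O)) => //.
  exact: open_measurable2.
apply: negligibleS => p /= /not_implyP [+ /eqP zp].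
by rewrite OE => -[n _ qp]; exists n.
Qed.

(** * Weak derivatives and Sobolev seminorms *)

Lemma ae2S (R : realType) (P Q : R * R -> Prop) : (forall p, P p -> Q p) ->
  {ae leb2 R, forall p, P p} -> {ae leb2 R, forall p, Q p}.
Proof. by move=> PQ [N [mN N0 PN]]; exists N; split => //; apply: subset_trans PN; exact: subsetC. Qed.

Lemma smooth_iter_pd (R : realType) i n (f : R * R -> R) :
  smooth f -> smooth (iter n (pd i) f).
Proof. by move=> sf; elim: n => [//|n IH]; exact: (@smooth_pd R i _ IH). Qed.

Lemma iter_pd_support (R : realType) i n (K : set (R * R)) (f : R * R -> R) : compact K ->
  (forall p, ~ K p -> f p = 0) -> forall p, ~ K p -> iter n (pd i) f p = 0.
Proof. by move=> cK f0; elim: n => [//|n IH]; exact: (@pd_support R i K _ cK IH). Qed.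

Lemma integration_by_parts_iter (R : realType) (O K : set (R * R)) i n (w f : R * R -> R) :
  meas2 R O -> compact K -> K `<=` O -> smooth w -> smooth f -> (forall p, ~ K p -> f p = 0) ->
  \int[leb2 R]_(p in O) (w p * iter n (pd i) f p) =
  (-1) ^+ n * \int[leb2 R]_(p in O) (iter n (pd i) w p * f p).
Proof.
move=> mO cK KO sw sf f0; elim: n w sw => [|n IH] w sw; first by rewrite mul1r.
rewrite iterS (integration_by_parts2 i mO cK KO (smooth_C1 sw)).
- by rewrite (IH _ (@smooth_pd _ i _ sw)) -iterSr exprS mulN1r mulNr.
- by apply: smooth_C1; exact: (@smooth_iter_pd R i n _ sf).
- exact: (@iter_pd_support R i n K _ cK f0).
Qed.

Lemma smooth_continuous (R : realType) (f : R * R -> R) : smooth f -> continuous f.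
Proof. by move=> /smooth_C1[]. Qed.

(** Integration by parts strips the outer derivatives of [pdn a b] first, and they land innermost on
    w; hence the order opposite to that of [pdn]. *)
Lemma smooth_is_weak_deriv (R : realType) (O : set (R * R)) a b (w : R * R -> R) :
  meas2 R O -> smooth w ->
  is_weak_deriv O a b w (iter b (pd true) (iter a (pd false) w)).
Proof.
move=> mO sw; split.
- by apply: loc_integrable_continuous; exact: smooth_continuous.
- apply: loc_integrable_continuous; apply: smooth_continuous.
  exact: (@smooth_iter_pd R true b _ (@smooth_iter_pd R false a _ sw)).
- move=> f tf; have [sf _ _] := tf; have [K [cK KO f0]] := test_fun_support tf.
  rewrite /pdn (integration_by_parts_iter false a mO cK KO sw).
  + have sa := @smooth_iter_pd R false a _ sw.
    by rewrite (integration_by_parts_iter true b mO cK KO sa sf f0) mulrA exprD.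
  + exact: (@smooth_iter_pd R true b _ sf).
  + exact: (@iter_pd_support R true b K _ cK f0).
Qed.

Lemma test_integrable (R : realType) (O : set (R * R)) (w f : R * R -> R) a b :
  meas2 R O -> loc_integrable2 O w -> test_fun O f ->
  (leb2 R).-integrable O (EFin \o (fun p => w p * pdn a b f p)).
Proof.
move=> mO lw tf; have [sf _ _] := tf; have [K [cK KO f0]] := test_fun_support tf.
apply: (integrable_mul_supp mO lw cK KO).
- apply: smooth_continuous; exact: (@smooth_iter_pd R false a _ (@smooth_iter_pd R true b _ sf)).
- exact: (@iter_pd_support R false a K _ cK (@iter_pd_support R true b K _ cK f0)).
Qed.

Lemma loc_integrableD (R : realType) (O : set (R * R)) (w v : R * R -> R) :
  loc_integrable2 O w -> loc_integrable2 O v -> loc_integrable2 O (w \+ v).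
Proof.
move=> lw lv K cK KO; have := integrableD (compact_measurable2 cK) (lw K cK KO) (lv K cK KO).
by apply: eq_integrable => //; exact: compact_measurable2.
Qed.

Lemma loc_integrableB (R : realType) (O : set (R * R)) (w v : R * R -> R) :
  loc_integrable2 O w -> loc_integrable2 O v -> loc_integrable2 O (w \- v).
Proof.
move=> lw lv K cK KO; have := integrableB (compact_measurable2 cK) (lw K cK KO) (lv K cK KO).
by apply: eq_integrable => //; exact: compact_measurable2.
Qed.

Lemma is_weak_derivD (R : realType) (O : set (R * R)) a b (w v g h : R * R -> R) :
  meas2 R O -> is_weak_deriv O a b w g -> is_weak_deriv O a b v h ->
  is_weak_deriv O a b (w \+ v) (g \+ h).
Proof.
move=> mO [lw lg wg] [lv lh vh]; split; [exact: loc_integrableD|exact: loc_integrableD|].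
move=> f tf; have := wg f tf; have := vh f tf => vhf wgf.
under eq_Rintegral do rewrite /= mulrDl.
under [in RHS]eq_Rintegral do rewrite /= mulrDl.
rewrite RintegralD ?wgf ?vhf; [|by []|exact: test_integrable|exact: test_integrable].
rewrite RintegralD ?mulrDr//; [exact: (@test_integrable _ _ _ _ 0 0)|exact: (@test_integrable _ _ _ _ 0 0)].
Qed.

Lemma is_weak_derivB (R : realType) (O : set (R * R)) a b (w v g h : R * R -> R) :
  meas2 R O -> is_weak_deriv O a b w g -> is_weak_deriv O a b v h ->
  is_weak_deriv O a b (w \- v) (g \- h).
Proof.
move=> mO [lw lg wg] [lv lh vh]; split; [exact: loc_integrableB|exact: loc_integrableB|].
move=> f tf; have := wg f tf; have := vh f tf => vhf wgf.
under eq_Rintegral do rewrite /= mulrBl.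
under [in RHS]eq_Rintegral do rewrite /= mulrBl.
rewrite RintegralB ?wgf ?vhf; [|by []|exact: test_integrable|exact: test_integrable].
rewrite RintegralB ?mulrBr//; [exact: (@test_integrable _ _ _ _ 0 0)|exact: (@test_integrable _ _ _ _ 0 0)].
Qed.

Lemma is_weak_deriv_unique (R : realType) (O : set (R * R)) a b (w g h : R * R -> R) :
  open O -> is_weak_deriv O a b w g -> is_weak_deriv O a b w h ->
  {ae leb2 R, forall p, O p -> g p = h p}.
Proof.
move=> oO [lw lg wg] [_ lh wh]; have mO := open_measurable2 oO.
have : {ae leb2 R, forall p, O p -> (g \- h) p = 0}.
  apply: (fundamental_lemma oO (loc_integrableB lg lh)) => f tf.
  under eq_Rintegral do rewrite /= mulrBl.
  rewrite RintegralB//; [|exact: (@test_integrable _ _ _ _ 0 0)|exact: (@test_integrable _ _ _ _ 0 0)].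
  apply: (@mulfI _ ((-1) ^+ (a + b))); first by rewrite signr_eq0.
  by rewrite mulrBr -wg// -wh// subrr mulr0.
by apply: ae2S => p h0 Op; apply/eqP; rewrite -subr_eq0; apply/eqP; exact: h0.
Qed.

Lemma weak_derivP (R : realType) (O : set (R * R)) a b (w g : R * R -> R) :
  is_weak_deriv O a b w g -> is_weak_deriv O a b w (weak_deriv O a b w).
Proof. by move=> wg; exact: (@xgetPex _ (fun=> 0) [set g | is_weak_deriv O a b w g] (ex_intro _ g wg)). Qed.

Lemma weak_deriv_ae (R : realType) (O : set (R * R)) a b (w g : R * R -> R) :
  open O -> is_weak_deriv O a b w g ->
  {ae leb2 R, forall p, O p -> weak_deriv O a b w p = g p}.
Proof. by move=> oO wg; exact: is_weak_deriv_unique oO (weak_derivP wg) wg. Qed.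

Lemma loc_integrable_measurable (R : realType) (O : set (R * R)) (g : R * R -> R) :
  open O -> loc_integrable2 O g -> mfun2 R O g.
Proof.
move=> /open_bigcup_box[q qO OE] lg.
have -> : O = \bigcup_n cbox (q n).
  apply/seteqP; split => p; last by move=> [n _ qp]; exact: qO qp.
  by rewrite OE => -[n _ qp]; exists n => //; exact: obox_sub_cbox.
apply/(@measurable_fun_bigcup _ _ (plane R) R) => n; first exact: cbox_measurable.
apply/measurable_EFinP; apply: measurable_int (lg _ (@cbox_compact _ (q n)) (qO n)).
Qed.

Lemma is_weak_deriv_measurable (R : realType) (O : set (R * R)) a b (w g : R * R -> R) :
  open O -> is_weak_deriv O a b w g -> mfun2 R O g.
Proof. by move=> oO [_ lg _]; exact: loc_integrable_measurable. Qed.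

(** Frees the seminorm from the choice hidden in [weak_deriv]: by uniqueness almost everywhere, any
    family of weak derivatives gives the same integral. *)
Lemma integral_weak_deriv_sq (R : realType) (O : set (R * R)) m (w : R * R -> R)
    (g : nat -> R * R -> R) : open O ->
  (forall k, (k <= m)%N -> is_weak_deriv O k (m - k) w (g k)) ->
  (Hseminorm_sq O m w = \int[leb2 R]_(p in O) (\sum_(k < m.+1) g k p ^+ 2)%:E)%E.
Proof.
move=> oO wg; have mO := open_measurable2 oO.
have wg' (k : 'I_m.+1) : is_weak_deriv O k (m - k) w (g k) by apply: wg; rewrite -ltnS.
apply: ge0_ae_eq_integral => //.
- apply/measurable_EFinP; apply: measurable_sum => k; apply: measurable_funX.
  exact: is_weak_deriv_measurable oO (weak_derivP (wg' k)).
- apply/measurable_EFinP; apply: measurable_sum => k; apply: measurable_funX.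
  exact: is_weak_deriv_measurable oO (wg' k).
- by move=> p _; rewrite lee_fin; apply: sumr_ge0 => k _; exact: sqr_ge0.
- by move=> p _; rewrite lee_fin; apply: sumr_ge0 => k _; exact: sqr_ge0.
- have : {ae leb2 R, forall p (k : nat), (k <= m)%N -> O p -> weak_deriv O k (m - k) w p = g k p}.
    apply/ae_foralln => k; have [km|km] := boolP (k <= m)%N.
      by apply: ae2S (weak_deriv_ae oO (wg k km)) => p h _; exact: h.
    exact: aeW.
  by apply: ae2S => p h Op; congr EFin; apply: eq_bigr => k _; rewrite h// -ltnS.
Qed.

(** * The function x^2 and its second-order seminorm *)

Lemma C1_cst (R : realType) (c : R) : C1 (cst c : R * R -> R) /\ forall i, pd i (cst c : R * R -> R) = cst 0.
Proof.
apply: (@C1_of_partials _ _ (fun=> cst 0)).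
- exact: cst_continuous.
- by move=> i; exact: cst_continuous.
Qed.

Lemma smooth_foldr_pd (R : realType) (f : R * R -> R) s : smooth f -> smooth (foldr (@pd R) f s).
Proof. by move=> sf r; have := sf (r ++ s); rewrite foldr_cat. Qed.

Lemma smoothB (R : realType) (f g : R * R -> R) : smooth f -> smooth g -> smooth (f \- g).
Proof.
move=> sf sg s.
have c1 r := smooth_C1 (smooth_foldr_pd r sf); have c2 r := smooth_C1 (smooth_foldr_pd r sg).
suff -> : foldr (@pd R) (f \- g) s = foldr (@pd R) f s \- foldr (@pd R) g s.
  have [[h1 h2] _] := C1B (c1 s) (c2 s).
  by split => // i p; have [_] := h2 i; exact.
elim: s => [//|i s IH]; rewrite /= IH.
by have [_ ->] := C1B (c1 s) (c2 s).
Qed.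

Lemma Coo_cst (R : realType) (c : R) : Coo (cst c : R -> R).
Proof.
move=> n; elim: n c => [|n IH] c; first exact: cst_continuous.
by exists (cst 0); split => // x; exact: is_derive_cst.
Qed.

Lemma Coo_id (R : realType) : Coo (@id R).
Proof.
case=> [|n]; first by move=> x; exact: cvg_id.
by exists (cst 1); split; [move=> x; exact: is_derive_id|exact: Coo_cst].
Qed.

Definition xsq (R : realType) (p : R * R) : R := p.1 ^+ 2.

Lemma xsqE (R : realType) : @xsq R = tensor (id \* id) (cst 1).
Proof. by apply/funext => p; rewrite /xsq /tensor /= mulr1. Qed.

Lemma smooth_xsq (R : realType) : smooth (@xsq R).
Proof.
by rewrite xsqE; apply: tensor_smooth; [move=> n; apply: CkM; exact: Coo_id|exact: Coo_cst].
Qed.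

Lemma pd_xsq (R : realType) i : pd i (@xsq R) = if i then cst 0 else tensor ( *%R 2) (cst 1).
Proof.
apply/funext => p.
have d1 : C1_deriv (id \* id : R -> R) ( *%R 2).
  move=> x; have := is_deriveM (is_derive_id x (1 : R)) (is_derive_id x (1 : R)).
  by rewrite /GRing.scale/= !mulr1 -mulr2n mulr_natl.
have d2 : C1_deriv (cst 1 : R -> R) (cst 0) by move=> x; exact: is_derive_cst.
rewrite xsqE (is_derive_pd (tensor_is_derive i p d1 d2)).
by case: i; rewrite // /tensor mulr0.
Qed.

Lemma pd_xsq2 (R : realType) i : pd i (pd false (@xsq R)) = if i then cst 0 else cst 2.
Proof.
apply/funext => p; rewrite pd_xsq.
have d1 : C1_deriv ( *%R 2 : R -> R) (cst 2).
  by move=> x; have := is_deriveZ (2 : R) (is_derive_id x (1 : R)); rewrite /GRing.scale/= mulr1.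
have d2 : C1_deriv (cst 1 : R -> R) (cst 0) by move=> x; exact: is_derive_cst.
rewrite (is_derive_pd (tensor_is_derive i p d1 d2)).
by case: i; rewrite // /tensor ?mulr0 ?mulr1.
Qed.

(** Only the second derivative in x survives; it is the constant 2. *)
Lemma Hseminorm_sq2_xsq (R : realType) (O : set (R * R)) : open O ->
  (Hseminorm_sq O 2 (@xsq R) = 4%:E * leb2 R O)%E.
Proof.
move=> oO; have mO := open_measurable2 oO.
rewrite (@integral_weak_deriv_sq _ _ _ _ (fun k => iter (2 - k) (pd true) (iter k (pd false) (@xsq R)))) //.
  rewrite -(integral_cst _ mO); apply: eq_integral => p _.
  rewrite !big_ord_recr big_ord0 /= pd_xsq pd_xsq2 (C1_cst 0).2 pd_xsq2 /cst /=; congr EFin; ring.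
by move=> k _; exact: (@smooth_is_weak_deriv _ _ _ _ _ mO (@smooth_xsq R)).
Qed.

(** * Comparison of the weak energy with that of smooth approximations *)

Definition grad_sq (R : realType) (f : R * R -> R) (p : R * R) : R :=
  pd false f p ^+ 2 + pd true f p ^+ 2.

Lemma grad_sq_continuous (R : realType) (f : R * R -> R) : C1 f -> continuous (grad_sq f).
Proof.
move=> [_ df] p; have [c0 _] := df false; have [c1 _] := df true.
exact: (cvgD (cvgM (c0 p) (c0 p)) (cvgM (c1 p) (c1 p))).
Qed.

Lemma integral_sum_sq_le (R : realType) (O : set (R * R)) m (a b c : nat -> R * R -> R) :
  meas2 R O -> (forall k, (k <= m)%N -> mfun2 R O (a k)) ->
  (forall k, (k <= m)%N -> mfun2 R O (b k)) ->
  (forall k, (k <= m)%N -> mfun2 R O (c k)) ->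
  (forall k p, a k p = b k p + c k p) ->
  (\int[leb2 R]_(p in O) (\sum_(k < m.+1) a k p ^+ 2)%:E <=
   2%:E * \int[leb2 R]_(p in O) (\sum_(k < m.+1) b k p ^+ 2)%:E +
   2%:E * \int[leb2 R]_(p in O) (\sum_(k < m.+1) c k p ^+ 2)%:E)%E.
Proof.
move=> mO ma mb mc abc.
have ms (f : nat -> R * R -> R) : (forall k, (k <= m)%N -> mfun2 R O (f k)) ->
    @measurable_fun _ _ (plane R) (\bar R) O (fun p => (\sum_(k < m.+1) f k p ^+ 2)%:E).
  move=> mf; apply/measurable_EFinP; apply: measurable_sum => k; apply: measurable_funX.
  by apply: mf; rewrite -ltnS.
have s0 (f : nat -> R * R -> R) p : (0 <= (\sum_(k < m.+1) f k p ^+ 2)%:E)%E.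
  by rewrite lee_fin; apply: sumr_ge0 => k _; exact: sqr_ge0.
rewrite -ge0_integralZl//; last exact: ms.
rewrite -ge0_integralZl//; last exact: ms.
rewrite -ge0_integralD//; last 4 first.
- by move=> p _; apply: mule_ge0 => //; exact: s0.
- by apply: measurable_funeM; exact: ms.
- by move=> p _; apply: mule_ge0 => //; exact: s0.
- by apply: measurable_funeM; exact: ms.
apply: ge0_le_integral => //.
- exact: ms.
- by apply: emeasurable_funD; apply: measurable_funeM; exact: ms.
- move=> p _; rewrite -!EFinM -EFinD lee_fin !mulr_sumr -big_split/=.
  apply: ler_sum => k _; rewrite abc -subr_ge0.
  have -> : 2 * b k p ^+ 2 + 2 * c k p ^+ 2 - (b k p + c k p) ^+ 2 = (b k p - c k p) ^+ 2 by ring.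
  exact: sqr_ge0.
Qed.

(** The first bound carries lower bounds for the classical gradient over to [u \- w]. The other two
    will make its seminorm finite, which matters because [Hseminorm] applies [fine], and an infinite
    energy would then count as 0. *)
Lemma Hseminorm1_approx (R : realType) (O K : set (R * R)) (u f w : R * R -> R) :
  open O -> compact K -> O `<=` K -> smooth u -> smooth f -> sobolev O 1 w ->
  [/\ (\int[leb2 R]_(p in O) (grad_sq (u \- f)%R p)%:E <=
        2%:E * Hseminorm_sq O 1 (u \- w)%R + 2%:E * Hseminorm_sq O 1 (f \- w)%R)%E,
      (Hseminorm_sq O 1 (u \- w)%R <=
        2%:E * \int[leb2 R]_(p in O) (grad_sq (u \- f)%R p)%:E + 2%:E * Hseminorm_sq O 1 (f \- w)%R)%E &
      (\int[leb2 R]_(p in O) (grad_sq (u \- f)%R p)%:E < +oo)%E].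
Proof.
move=> oO cK OK su sf sw; have mO := open_measurable2 oO.
have suf := smoothB su sf.
pose a k := iter (1 - k) (pd true) (iter k (pd false) (u \- f)).
pose b k := weak_deriv O k (1 - k) (f \- w).
have wa k : is_weak_deriv O k (1 - k) (u \- f) (a k).
  exact: (@smooth_is_weak_deriv _ _ k (1 - k) _ mO suf).
have wb k : (k <= 1)%N -> is_weak_deriv O k (1 - k) (f \- w) (b k).
  move=> k1; have [|g wg _] := sw k (1 - k)%N; first by rewrite subnKC.
  have wf := @smooth_is_weak_deriv _ _ k (1 - k) _ mO sf.
  exact: weak_derivP (is_weak_derivB mO wf wg).
have wab k : (k <= 1)%N -> is_weak_deriv O k (1 - k) (u \- w) (a k \+ b k).
  move=> k1; have := is_weak_derivD mO (wa k) (wb k k1).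
  by congr (is_weak_deriv _ _ _ _ _); apply/funext => p /=; ring.
have ma k : (k <= 1)%N -> mfun2 R O (a k) by move=> _; exact: is_weak_deriv_measurable oO (wa k).
have mb k : (k <= 1)%N -> mfun2 R O (b k) by move=> k1; exact: is_weak_deriv_measurable oO (wb k k1).
have mab k : (k <= 1)%N -> mfun2 R O (a k \+ b k).
  by move=> k1; exact: is_weak_deriv_measurable oO (wab k k1).
have E : (\int[leb2 R]_(p in O) (grad_sq (u \- f)%R p)%:E =
    \int[leb2 R]_(p in O) (\sum_(k < 2) a k p ^+ 2)%:E)%E.
  by apply: eq_integral => p _; rewrite !big_ord_recr big_ord0 /= add0r addrC.
have D : (Hseminorm_sq O 1 (u \- w)%R =
    \int[leb2 R]_(p in O) (\sum_(k < 2) (a k \+ b k)%R p ^+ 2)%:E)%E.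
  exact: (@integral_weak_deriv_sq _ _ _ _ (fun k => a k \+ b k) oO).
split.
- rewrite E D.
  (* Writing a as (a + b) + (- b) runs the same estimate in the other direction. *)
  have bN : Hseminorm_sq O 1 (f \- w)%R =
      (\int[leb2 R]_(p in O) (\sum_(k < 2) (\- b k)%R p ^+ 2)%:E)%E.
    by apply: eq_integral => p _; congr EFin; apply: eq_bigr => k _; rewrite /= sqrrN.
  rewrite bN; apply: (@integral_sum_sq_le R O 1 a (fun k => a k \+ b k) (fun k => \- b k)) => //.
  + by move=> k k1; apply: measurableT_comp => //; exact: mb.
  + by move=> k p /=; ring.
- by rewrite E D; exact: (@integral_sum_sq_le R O 1 (fun k => a k \+ b k) a b).
- have := continuous_integrable2 (grad_sq_continuous (smooth_C1 suf)) cK OK mO.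
  move=> /(integrable_fin_num mO) /= h.
  by rewrite -(fineK h) ltry.
Qed.

(** * Dirichlet energy along half-square arcs *)

(** Cutting off by an indicator instead of a domain of integration lets Tonelli run over whole
    lines, without sections of O. *)
Definition cut_grad (R : realType) (O : set (R * R)) (f : R * R -> R) (p : plane R) : \bar R :=
  (grad_sq f p * \1_O p)%:E.

Lemma grad_sq_ge0 (R : realType) (f : R * R -> R) p : 0 <= grad_sq f p.
Proof. by rewrite /grad_sq addr_ge0 ?sqr_ge0. Qed.

Lemma pd_sq_le (R : realType) i (f : R * R -> R) p : pd i f p ^+ 2 <= pd false f p ^+ 2 + pd true f p ^+ 2.
Proof. by case: i; [rewrite lerDr sqr_ge0|rewrite lerDl sqr_ge0]. Qed.

Lemma cut_grad_ge0 (R : realType) (O : set (R * R)) (f : R * R -> R) p : (0 <= cut_grad O f p)%E.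
Proof. by rewrite lee_fin mulr_ge0 ?grad_sq_ge0. Qed.

Lemma measurable_cut_grad (R : realType) (O : set (R * R)) (f : R * R -> R) :
  meas2 R O -> C1 f -> @measurable_fun _ _ (plane R) (\bar R) setT (cut_grad O f).
Proof.
move=> mO hf; apply/measurable_EFinP; apply: measurable_funM.
  exact: (continuous_measurable2 (grad_sq_continuous hf) measurableT).
exact: measurable_indic.
Qed.

Lemma integral_cut_grad (R : realType) (O : set (R * R)) (f : R * R -> R) :
  (\int[leb2 R]_p cut_grad O f p = \int[leb2 R]_(p in O) (grad_sq f p)%:E)%E.
Proof.
rewrite [RHS]integral_mkcond; apply: eq_integral => p _.
rewrite patchE /cut_grad indicE; case: ifPn => _; first by rewrite mulr1.
by rewrite mulr0.
Qed.

Lemma measurable_lineOf (R : realType) i (p : R * R) :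
  @measurable_fun _ _ (measurableTypeR R) (plane R) setT (lineOf i p).
Proof. by case: i; apply: measurable_fun_pair. Qed.

(* Integrates 2 l X - l^2 <= X^2; optimizing the free slope l replaces the
   Cauchy-Schwarz inequality. *)
Lemma line_energy (R : realType) (O : set (R * R)) (f : R * R -> R) i p (a b l : R) :
  meas2 R O -> C1 f -> a <= b -> (forall t, a < t < b -> O (lineOf i p t)) ->
  ((2 * l * (f (lineOf i p b) - f (lineOf i p a)) - l ^+ 2 * (b - a))%:E <=
   \int[lebesgue_measure]_t cut_grad O f (lineOf i p t))%E.
Proof.
move=> mO hf ab lO; have [df cf] := C1_line i p hf.
pose X t := pd i f (lineOf i p t).
have dF t : is_derive t (1 : R) (fun t => 2 * l * f (lineOf i p t) - l ^+ 2 * t)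
    (2 * l * X t - l ^+ 2).
  have := is_deriveB (is_deriveZ (2 * l) (df t)) (is_deriveZ (l ^+ 2) (is_derive_id t (1 : R))).
  by rewrite /GRing.scale/= mulr1.
have cF : continuous (fun t => 2 * l * X t - l ^+ 2).
  move=> t; apply: cvgB; last exact: cvg_cst.
  by apply: cvgM; [exact: cvg_cst|exact: cf].
have cX2 : continuous (fun t => X t ^+ 2) by move=> t; exact: cvgM (cf t) (cf t).
have mX2 : measurable_fun setT (fun t => X t ^+ 2) by exact: continuous_measurable_fun.
have mG : measurable_fun setT (fun t => cut_grad O f (lineOf i p t)).
  by apply: (measurableT_comp (measurable_cut_grad mO hf)); exact: measurable_lineOf.
apply: (@le_trans _ _ (\int[lebesgue_measure]_(t in `[a, b]) (X t ^+ 2)%:E)%E).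
  have -> : ((2 * l * (f (lineOf i p b) - f (lineOf i p a)) - l ^+ 2 * (b - a))%:E =
     \int[lebesgue_measure]_(t in `[a, b]) (2 * l * X t - l ^+ 2)%:E)%E.
    by rewrite (FTC_C1 ab dF cF); congr EFin; ring.
  have ci (g : R -> R) : continuous g ->
      (@lebesgue_measure R).-integrable `[a, b] (EFin \o g).
    by move=> cg; apply: continuous_compact_integrable; [exact: segment_compact|exact: continuous_subspaceT].
  apply: le_integral; [by []|exact: ci|exact: ci|].
  move=> t _; rewrite lee_fin -subr_ge0.
  have -> : X t ^+ 2 - (2 * l * X t - l ^+ 2) = (X t - l) ^+ 2 by ring.
  exact: sqr_ge0.
(* Only the open segment is known to lie in O, since an arc begins and ends on the boundary; the two
   end points are null. *)
rewrite (@integral_itv_bndoo _ a b _ true false); last first.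
  by apply/measurable_EFinP; exact: measurable_funS mX2.
apply: (@le_trans _ _ (\int[lebesgue_measure]_(t in `]a, b[) cut_grad O f (lineOf i p t))%E).
  apply: ge0_le_integral => //.
  - by move=> t _; rewrite lee_fin sqr_ge0.
  - by apply/measurable_EFinP; exact: measurable_funS mX2.
  - exact: measurable_funS mG.
  - move=> t; rewrite /= in_itv/= => /lO Ot.
    rewrite /cut_grad lee_fin indicE mem_set// mulr1 /grad_sq /X.
    exact: pd_sq_le.
by apply: ge0_subset_integral => // t _; exact: cut_grad_ge0.
Qed.

Definition col_energy (R : realType) O (f : R * R -> R) (x : R) : \bar R :=
  (\int[lebesgue_measure]_y cut_grad O f (x, y))%E.

Definition row_energy (R : realType) O (f : R * R -> R) (y : R) : \bar R :=
  (\int[lebesgue_measure]_x cut_grad O f (x, y))%E.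

Lemma col_energy_integral (R : realType) (O : set (R * R)) (f : R * R -> R) :
  meas2 R O -> C1 f ->
  measurable_fun setT (col_energy O f) /\
  (\int[lebesgue_measure]_x col_energy O f x = \int[leb2 R]_(p in O) (grad_sq f p)%:E)%E.
Proof.
move=> mO hf; have mG := measurable_cut_grad mO hf; split.
  exact: (measurable_fun_fubini_tonelli_F (cut_grad O f) mG (cut_grad_ge0 O f)).
by rewrite -integral_cut_grad; apply/esym; exact: (fubini_tonelli1 (cut_grad O f) mG (cut_grad_ge0 O f)).
Qed.

Lemma row_energy_integral (R : realType) (O : set (R * R)) (f : R * R -> R) :
  meas2 R O -> C1 f ->
  measurable_fun setT (row_energy O f) /\
  (\int[lebesgue_measure]_x row_energy O f x = \int[leb2 R]_(p in O) (grad_sq f p)%:E)%E.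
Proof.
move=> mO hf; have mG := measurable_cut_grad mO hf; split.
  exact: (measurable_fun_fubini_tonelli_G (cut_grad O f) mG (cut_grad_ge0 O f)).
by rewrite -integral_cut_grad; apply/esym; exact: (fubini_tonelli2 (cut_grad O f) mG (cut_grad_ge0 O f)).
Qed.

Lemma ge0_integralN (R : realType) (f : R -> \bar R) :
  measurable_fun setT f -> (forall x, 0 <= f x)%E ->
  (\int[lebesgue_measure]_x f (- x)%R = \int[lebesgue_measure]_x f x)%E.
Proof.
move=> mf f0.
have mN : @measurable_fun _ _ (measurableTypeR R) (measurableTypeR R) setT (-%R : R -> R).
  exact: (@oppr_measurable R setT).
rewrite [RHS](eq_measure_integral (pushforward lebesgue_measure (-%R : R -> measurableTypeR R))).
  by rewrite ge0_integral_pushforward.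
by move=> A mA _; apply/esym; exact: lebesgue_measureN.
Qed.

(** The three sides sweep the lines x = r, y = r and x = - r. Once r is let range over the whole
    line, Tonelli yields the full energy for each side. *)
Lemma radial_energy (R : realType) (O : set (R * R)) (f : R * R -> R) (a b : R) :
  meas2 R O -> C1 f ->
  (\int[lebesgue_measure]_(r in `[a, b])
     (col_energy O f r + row_energy O f r + col_energy O f (- r)) <=
   3%:E * \int[leb2 R]_(p in O) (grad_sq f p)%:E)%E.
Proof.
move=> mO hf; have [mc ic] := col_energy_integral mO hf; have [mr ir] := row_energy_integral mO hf.
have mN : @measurable_fun _ _ (measurableTypeR R) (measurableTypeR R) setT (-%R : R -> R).
  exact: (@oppr_measurable R setT).
have mcN : measurable_fun setT (fun r : R => col_energy O f (- r)) by exact: (measurableT_comp mc mN).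
have c0 x : (0 <= col_energy O f x)%E by apply: integral_ge0 => y _; exact: cut_grad_ge0.
have r0 x : (0 <= row_energy O f x)%E by apply: integral_ge0 => y _; exact: cut_grad_ge0.
apply: (@le_trans _ _ (\int[lebesgue_measure]_r
     (col_energy O f r + row_energy O f r + col_energy O f (- r)))%E).
  apply: ge0_subset_integral => //.
    by apply: emeasurable_funD => //; exact: emeasurable_funD.
  by move=> x _; apply: adde_ge0; [apply: adde_ge0; [exact: c0|exact: r0]|exact: c0].
rewrite ge0_integralD//; [|by move=> x _; rewrite adde_ge0|exact: emeasurable_funD].
rewrite ge0_integralD// ic ir ge0_integralN// ic.
set E := (X in (X + X + X)%E).
have -> : (3%:E = 1 + 1 + 1 :> \bar R)%E by rewrite -!EFinD; congr EFin; ring.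
rewrite ge0_muleDl ?adde_ge0// ge0_muleDl// !mul1e; exact: lexx.
Qed.

Lemma integral_inv (R : realType) (a b : R) : 0 < a -> a < b ->
  (\int[lebesgue_measure]_(r in `[a, b]) (r^-1)%:E = (ln b - ln a)%:E)%E.
Proof.
move=> a0 ab; rewrite EFinB; apply: continuous_FTC2 => //.
- apply: continuous_in_subspaceT => x; rewrite inE/= in_itv/= => /andP[ax _].
  by apply: inv_continuous; rewrite gt_eqF// (lt_le_trans a0).
- split.
  + move=> x; rewrite in_itv/= => /andP[ax _].
    by apply: ex_derive; apply: is_derive1_ln; exact: lt_trans ax.
  + by apply/cvg_at_right_filter/continuous_ln.
  + by apply/cvg_at_left_filter/continuous_ln; exact: lt_trans ab.
- move=> x; rewrite in_itv/= => /andP[ax _].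
  by rewrite derive1E (@derive_val _ _ _ _ _ _ _ (is_derive1_ln (lt_trans a0 ax))).
Qed.

(** * Passage from the radius to the parameter of an edge *)

Lemma affine_substitution (R : realType) (C : R -> R) (c d : R) : continuous C -> 0 < c ->
  (\int[lebesgue_measure]_(r in `[d, (c + d)%R]) (C ((r - d) / c))%:E =
   c%:E * \int[lebesgue_measure]_(t in `[0%R, 1%R]) (C t)%:E)%E.
Proof.
move=> cC c0.
pose F (t : R) := c * t + d.
have dF (x : R) : is_derive x (1 : R) F c.
  have := is_deriveD (is_deriveZ c (is_derive_id x (1 : R)))
                     (is_derive_cst (d : R) x (1 : R)).
  by rewrite addr0 /GRing.scale/= mulr1.
have F'E : derive1 F = cst c.
  by apply/funext => x; rewrite derive1E (@derive_val _ _ _ _ _ _ _ (dF x)).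
have cF : continuous F.
  by move=> x; apply/differentiable_continuous/derivable1_diffP; exact: (@ex_derive _ _ _ _ _ _ _ (dF x)).
have cG : continuous (fun r => C ((r - d) / c)).
  move=> r; apply: (@continuous_comp _ _ _ (fun r => (r - d) / c) C); last exact: cC.
  by apply: cvgM; [apply: cvgB; [exact: cvg_id|exact: cvg_cst]|exact: cvg_cst].
have F0 : F 0 = d by rewrite /F mulr0 add0r.
have F1 : F 1 = c + d by rewrite /F mulr1.
rewrite -F1 -{1}F0 (@integration_by_substitution_increasing _ F _ 0 1) //.
- rewrite F'E -integralZl//=.
    apply: eq_integral => t _; rewrite -EFinM; congr EFin.
    by rewrite /= mulrfctE /= /F addrK mulrAC divff ?mul1r 1?mulrC// gt_eqF.
  by apply: continuous_compact_integrable; [exact: segment_compact|exact: continuous_subspaceT].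
- by move=> x y _ _ xy; rewrite /F ltrD2r ltr_pM2l.
- by rewrite F'E => x _; exact: cst_continuous.
- by rewrite F'E; apply: is_cvg_cst.
- by rewrite F'E; apply: is_cvg_cst.
- split; [by move=> x _; exact: (@ex_derive _ _ _ _ _ _ _ (dF x))|exact/cvg_at_right_filter/cF|exact/cvg_at_left_filter/cF].
- exact: continuous_subspaceT.
Qed.

(* On [r = c * t + d], the value of C at t; it transports an integral over the
   parameter of an edge to one over the radius r. *)
Definition edge_term (R : realType) (C : R -> R) (c d r : R) : R :=
  if c == 0 then 0 else C ((r - d) / c) * \1_`[0, 1] ((r - d) / c).

Lemma edge_term_ge0 (R : realType) (C : R -> R) (c d r : R) :
  (forall t, 0 <= C t) -> 0 <= edge_term C c d r.
Proof. by move=> C0; rewrite /edge_term; case: ifP => // _; rewrite mulr_ge0. Qed.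

Lemma measurable_edge_term (R : realType) (C : R -> R) (c d : R) :
  continuous C -> measurable_fun setT (edge_term C c d).
Proof.
move=> cC; have [c0|cN0] := eqVneq c 0.
  have -> : edge_term C c d = cst 0 by apply/funext => r; rewrite /edge_term c0 eqxx.
  exact: measurable_cst.
have -> : edge_term C c d = (fun r => C ((r - d) / c) * \1_`[0, 1] ((r - d) / c)).
  by apply/funext => r; rewrite /edge_term (negbTE cN0).
have cF : continuous (fun r => (r - d) / c).
  move=> r; apply: cvgM; last exact: cvg_cst.
  by apply: cvgB; [exact: cvg_id|exact: cvg_cst].
have mF := continuous_measurable_fun cF.
apply: measurable_funM.
  by apply: (measurableT_comp _ mF); exact: continuous_measurable_fun.
by apply: (measurableT_comp _ mF); apply: measurable_indic; exact: measurable_itv.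
Qed.

Lemma edge_term_integral_pos (R : realType) (C : R -> R) (c d : R) :
  continuous C -> (forall t, 0 <= C t) -> 0 < c ->
  (\int[lebesgue_measure]_r (edge_term C c d r)%:E =
   c%:E * \int[lebesgue_measure]_(t in `[0%R, 1%R]) (C t)%:E)%E.
Proof.
move=> cC C0 c0; rewrite -(affine_substitution d cC c0) [RHS]integral_mkcond.
apply: eq_integral => r _; rewrite /edge_term gt_eqF// patchE indicE.
have -> : (r \in `[d, c + d]%classic) = ((r - d) / c \in `[0, 1]%classic).
  by apply/idP/idP; rewrite !inE /= !in_itv/= ler_pdivlMr// mul0r ler_pdivrMr// mul1r subr_ge0 lerBlDr.
by case: ifP => _; rewrite ?mulr1 ?mulr0.
Qed.

(** A negative slope is reduced to a positive one by reflecting r. For c = 0 both sides vanish,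
    which is why the default value in [edge_term] is 0. *)
Lemma edge_term_integral (R : realType) (C : R -> R) (c d : R) :
  continuous C -> (forall t, 0 <= C t) ->
  (\int[lebesgue_measure]_r (edge_term C c d r)%:E =
   `|c|%:E * \int[lebesgue_measure]_(t in `[0%R, 1%R]) (C t)%:E)%E.
Proof.
move=> cC C0; have [c0|c0|c0] := ltgtP 0 c.
- by rewrite gtr0_norm//; exact: edge_term_integral_pos.
- rewrite ltr0_norm// -(edge_term_integral_pos (- d)) ?oppr_gt0//.
  rewrite -[RHS]ge0_integralN.
  + apply: eq_integral => r _; rewrite /edge_term oppr_eq0.
    by congr (if _ then _ else _)%:E; rewrite invrN mulrN -mulNr opprB opprK addrC.
  + by apply/measurable_EFinP; exact: measurable_edge_term.
  + by move=> r; rewrite lee_fin; exact: edge_term_ge0.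
- rewrite -c0 normr0 mul0e integral0_eq// => r _.
  by rewrite /edge_term eqxx.
Qed.

(* Arc-length parametrization over [0, 4r] of the upper half of the boundary of
   the square [-r, r]^2, from (r, 0) to (- r, 0). *)
Definition gam (R : realType) (r s : R) : R * R :=
  (Num.max (- r) (Num.min r (2 * r - s)), Num.min r (Num.min s (4 * r - s))).

Lemma gam_right (R : realType) (r s : R) : 0 <= s <= r -> gam r s = (r, s).
Proof.
move=> /andP[s0 sr]; rewrite /gam.
rewrite [Num.min r (2 * r - s)]min_l; last by lra.
rewrite [Num.min s _]min_l; last by lra.
by rewrite max_r ?min_r//; lra.
Qed.

Lemma gam_top (R : realType) (r s : R) : 0 <= r -> r <= s <= 3 * r -> gam r s = (2 * r - s, r).
Proof.
move=> r0 /andP[s0 sr]; rewrite /gam.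
rewrite [Num.min r (2 * r - s)]min_r; last by lra.
rewrite max_r; last by lra.
by rewrite min_l// le_min; apply/andP; split; lra.
Qed.

Lemma gam_left (R : realType) (r s : R) : 0 <= r -> 3 * r <= s <= 4 * r ->
  gam r s = (- r, 4 * r - s).
Proof.
move=> r0 /andP[s0 sr]; rewrite /gam.
rewrite [Num.min r (2 * r - s)]min_r; last by lra.
rewrite max_l; last by lra.
rewrite [Num.min s _]min_r; last by lra.
by rewrite min_r//; lra.
Qed.

Lemma gam_continuous (R : realType) (r : R) : continuous (gam r).
Proof.
have c2 (a : R) : continuous (fun s : R => a - s).
  by move=> s; apply: cvgB; [exact: cvg_cst|exact: cvg_id].
have cmin (f g : R -> R) : continuous f -> continuous g -> continuous (f \min g).
  by move=> cf cg x; apply: (@continuous_min _ _ f g x); [exact: cf|exact: cg].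
have cmax (f g : R -> R) : continuous f -> continuous g -> continuous (f \max g).
  by move=> cf cg x; apply: (@continuous_max _ _ f g x); [exact: cf|exact: cg].
have cc (a : R) : continuous (cst a : R -> R) by exact: cst_continuous.
have ci : continuous (@id R) by move=> x; exact: cvg_id.
apply: continuous_pair.
  exact: (cmax _ _ (cc (- r)) (cmin _ _ (cc r) (c2 (2 * r)))).
exact: (cmin _ _ (cc r) (cmin _ _ ci (c2 (4 * r)))).
Qed.

(** [line_energy] is applied to each side reached, with one common l, so that the increments of f
    telescope. The top and left sides are traversed against their coordinate, hence the slope [- l]
    there. The length s is finally replaced by 4 r. *)
Lemma arc_energy (R : realType) (O : set (R * R)) (f : R * R -> R) (r s l : R) :
  meas2 R O -> C1 f -> 0 < r -> 0 < s <= 4 * r ->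
  (forall t, 0 < t < s -> O (gam r t)) ->
  ((2 * l * (f (gam r s) - f (r, 0)) - l ^+ 2 * (4 * r))%:E <=
   col_energy O f r + row_energy O f r + col_energy O f (- r))%E.
Proof.
move=> mO hf r0 /andP[s0 s4] Og.
have c0 x : (0 <= col_energy O f x)%E by apply: integral_ge0 => y _; exact: cut_grad_ge0.
have r0' x : (0 <= row_energy O f x)%E by apply: integral_ge0 => y _; exact: cut_grad_ge0.
have l0 : 0 <= l ^+ 2 := sqr_ge0 l.
have E1 b : 0 <= b <= r -> b <= s ->
    ((2 * l * (f (r, b) - f (r, 0)) - l ^+ 2 * b)%:E <= col_energy O f r)%E.
  move=> /andP[b0 br] bs.
  have := @line_energy R O f true (r, 0) 0 b l mO hf b0.
  rewrite /= subr0; apply => t /andP[t0 tb].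
  rewrite -gam_right; first by apply: Og; rewrite t0 (lt_le_trans tb).
  by rewrite ltW//= ltW// (lt_le_trans tb).
have E2 a : - r <= a <= r -> 2 * r - s <= a ->
    ((2 * l * (f (a, r) - f (r, r)) - l ^+ 2 * (r - a))%:E <= row_energy O f r)%E.
  move=> /andP[ra ar] sa.
  have := @line_energy R O f false (0, r) a r (- l) mO hf ar.
  rewrite sqrrN (_ : 2 * - l * _ = 2 * l * (f (a, r) - f (r, r))); last by rewrite /=; ring.
  apply => t /andP[ta tr]; have -> : lineOf false (0, r) t = gam r (2 * r - t).
    by rewrite gam_top ?(ltW r0) ?subKr//; apply/andP; split; lra.
  by apply: Og; apply/andP; split; lra.
have E3 a : 0 <= a <= r -> 4 * r - s <= a ->
    ((2 * l * (f (- r, a) - f (- r, r)) - l ^+ 2 * (r - a))%:E <= col_energy O f (- r))%E.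
  move=> /andP[a0 ar] sa.
  have := @line_energy R O f true (- r, 0) a r (- l) mO hf ar.
  rewrite sqrrN (_ : 2 * - l * _ = 2 * l * (f (- r, a) - f (- r, r))); last by rewrite /=; ring.
  apply => t /andP[ta tr]; have -> : lineOf true (- r, 0) t = gam r (4 * r - t).
    by rewrite gam_left ?(ltW r0) ?subKr//; apply/andP; split; lra.
  by apply: Og; apply/andP; split; lra.
have [sr|rs] := leP s r.
  rewrite gam_right; last by rewrite ltW.
  apply: (@le_trans _ _ (col_energy O f r)).
    apply: le_trans (E1 s _ _); rewrite ?lexx ?(ltW s0)//= lee_fin lerD2l lerN2 ler_wpM2l//; lra.
  by rewrite -addeA leeDl// adde_ge0.
have [s3|s3] := leP s (3 * r).
  rewrite gam_top ?(ltW r0)//; last by rewrite ltW.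
  apply: (@le_trans _ _ (col_energy O f r + row_energy O f r)%E); last by rewrite leeDl.
  have := leeD (E1 r _ (ltW rs)) (E2 (2 * r - s) _ (lexx _)).
  move=> h; apply: le_trans (h _ _); rewrite -?EFinD ?lee_fin; [|lra..|].
    have : l ^+ 2 * s <= l ^+ 2 * (4 * r) by rewrite ler_wpM2l.
    by lra.
  by apply/andP; split; lra.
rewrite gam_left ?(ltW r0)//; last by rewrite ltW.
have h1 : 0 <= r <= r by apply/andP; split; lra.
have h2 : - r <= - r <= r by apply/andP; split; lra.
have h3 : 0 <= 4 * r - s <= r by apply/andP; split; lra.
have := leeD (leeD (E1 r h1 (ltW rs)) (E2 (- r) h2 _)) (E3 (4 * r - s) h3 (lexx _)).
move=> h; apply: le_trans (h _); rewrite -?EFinD ?lee_fin; last by lra.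
have : l ^+ 2 * s <= l ^+ 2 * (4 * r) by rewrite ler_wpM2l.
by lra.
Qed.

(** The logarithm is the integral of 1 / r. The error [c * E r] is integrated over the whole line,
    where it will be a boundary integral. *)
Lemma log_energy (R : realType) (O : set (R * R)) (f : R * R -> R) (E : R -> R) (K a b c : R) :
  meas2 R O -> C1 f -> 0 < a -> a < b -> 0 <= c ->
  measurable_fun setT E -> (forall r, 0 <= E r) ->
  (forall r, a <= r <= b -> ((K / r)%:E <=
     col_energy O f r + row_energy O f r + col_energy O f (- r) + (c * E r)%:E)%E) ->
  0 <= K ->
  ((K * (ln b - ln a))%:E <= 3%:E * \int[leb2 R]_(p in O) (grad_sq f p)%:E +
     c%:E * \int[lebesgue_measure]_r (E r)%:E)%E.
Proof.
move=> mO hf a0 ab c0 mE E0 hr K0.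
have [mc ic] := col_energy_integral mO hf; have [mr ir] := row_energy_integral mO hf.
have mN : @measurable_fun _ _ (measurableTypeR R) (measurableTypeR R) setT (-%R : R -> R).
  exact: (@oppr_measurable R setT).
have mcN : measurable_fun setT (fun r : R => col_energy O f (- r)) by exact: (measurableT_comp mc mN).
have ce0 x : (0 <= col_energy O f x)%E by apply: integral_ge0 => y _; exact: cut_grad_ge0.
have re0 x : (0 <= row_energy O f x)%E by apply: integral_ge0 => y _; exact: cut_grad_ge0.
have mA : measurable_fun setT (fun r : R => col_energy O f r + row_energy O f r + col_energy O f (- r))%E.
  by apply: emeasurable_funD => //; exact: emeasurable_funD.
have A0 r : (0 <= col_energy O f r + row_energy O f r + col_energy O f (- r))%E.
  by apply: adde_ge0; [apply: adde_ge0; [exact: ce0|exact: re0]|exact: ce0].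
have mcE : measurable_fun setT (fun r => (c * E r)%:E) by apply/measurable_EFinP; exact: measurable_funM.
have pos r : a <= r <= b -> 0 < r by move=> /andP[ar _]; exact: lt_le_trans ar.
have minv : measurable_fun `[a, b] (fun r : R => r^-1).
  apply: subspace_continuous_measurable_fun => //; apply: continuous_in_subspaceT => x.
  rewrite inE/= in_itv/= => /pos x0; apply: inv_continuous; exact: lt0r_neq0.
apply: (@le_trans _ _ (\int[lebesgue_measure]_(r in `[a, b])
   (col_energy O f r + row_energy O f r + col_energy O f (- r) + (c * E r)%:E))%E).
  rewrite EFinM -integral_inv// -ge0_integralZl//.
  - apply: ge0_le_integral => //.
    + move=> r; rewrite /= in_itv/= => /pos r0.
      by rewrite mule_ge0// lee_fin invr_ge0 ltW.
    + by apply: measurable_funeM; apply/measurable_EFinP.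
    + apply: emeasurable_funD; first exact: measurable_funS mA.
      exact: measurable_funS mcE.
  - by apply/measurable_EFinP.
  - by move=> r; rewrite /= in_itv/= => /pos r0; rewrite lee_fin invr_ge0 ltW.
rewrite ge0_integralD//; last 3 first.
- exact: measurable_funS mA.
- by move=> r _; rewrite lee_fin mulr_ge0.
- exact: measurable_funS mcE.
apply: leeD; first exact: radial_energy.
have <- : (\int[lebesgue_measure]_r (c * E r)%:E = c%:E * \int[lebesgue_measure]_r (E r)%:E)%E.
  under eq_integral do rewrite EFinM.
  rewrite ge0_integralZl//; first exact/measurable_EFinP.
  by move=> r _; rewrite lee_fin.
by apply: ge0_subset_integral => // r _; rewrite lee_fin mulr_ge0.
Qed.

(** * Geometry of the polygon near the vertex *)

Lemma seg_pt_continuous (R : realType) (e : (R * R) * (R * R)) : continuous (seg_pt e).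
Proof.
have h (x y : R) : continuous (fun t : R => (1 - t) * x + t * y).
  move=> t; apply: cvgD; apply: cvgM; try exact: cvg_cst; last exact: cvg_id.
  by apply: cvgB; [exact: cvg_cst|exact: cvg_id].
by apply: continuous_pair; exact: h.
Qed.

Lemma seg_compact (R : realType) (e : (R * R) * (R * R)) : compact (seg e).
Proof.
apply: continuous_compact; last exact: segment_compact.
by apply: continuous_subspaceT; exact: seg_pt_continuous.
Qed.

Lemma seg_connected (R : realType) (e : (R * R) * (R * R)) : connected (seg e).
Proof.
apply: connected_continuous_connected; first exact: segment_connected.
by apply: continuous_subspaceT; exact: seg_pt_continuous.
Qed.

Lemma edges_compact (R : realType) (l : seq ((R * R) * (R * R))) :
  compact [set p : R * R | exists2 e, e \in l & seg e p].
Proof.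
elim: l => [|e l IH].
  rewrite (_ : [set p | _] = set0); first exact: compact0.
  by apply/seteqP; split => // p [e].
rewrite (_ : [set p | _] = seg e `|` [set p | exists2 e, e \in l & seg e p]).
  by apply: compactU => //; exact: seg_compact.
apply/seteqP; split => p.
  by move=> [e']; rewrite inE => /predU1P[->|el] ep; [left|right; exists e'].
by move=> [ep|[e' el ep]]; [exists e; rewrite ?mem_head|exists e'; rewrite // inE el orbT].
Qed.

Lemma poly_boundary_compact (R : realType) (s : seq (R * R)) : compact (poly_boundary s).
Proof. exact: edges_compact. Qed.

Lemma poly_boundaryC_open (R : realType) (s : seq (R * R)) : open (~` poly_boundary s).
Proof.
apply: closed_openC; apply: compact_closed; first exact: plane_hausdorff.
exact: poly_boundary_compact.
Qed.

(** The interior is a union of components of the complement of the boundary, so a connected set that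
    avoids the boundary cannot leave it. *)
Lemma poly_interior_connected (R : realType) (s : seq (R * R)) (C : set (R * R)) p q :
  poly_interior s p -> connected C -> C `<=` ~` poly_boundary s -> C p -> C q ->
  poly_interior s q.
Proof.
move=> [bp cp] cC Cs Cp Cq; split; first exact: Cs.
rewrite -(@same_connected_component _ (~` poly_boundary s) p q)//.
exact: (connected_component_max Cp Cs cC).
Qed.

(** A small box around p avoids the boundary, and segments from p stay in that box. *)
Lemma poly_interior_open (R : realType) (s : seq (R * R)) : open (poly_interior s).
Proof.
rewrite openE => p ip.
have /nbhs_obox[e e0 eA] : nbhs p (~` poly_boundary s).
  by apply: open_nbhs_nbhs; split; [exact: poly_boundaryC_open|case: ip].
exists (ball p.1 e, ball p.2 e); first by split; exact: nbhsx_ballx.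
move=> q [/=]; rewrite /ball/= => q1 q2.
apply: (@poly_interior_connected _ _ (seg (p, q)) p q ip).
- exact: seg_connected.
- move=> z [t /=]; rewrite in_itv/= => /andP[t0 t1] <-; apply: eA; rewrite /seg_pt/=.
    have -> : (1 - t) * p.1 + t * q.1 - p.1 = - (t * (p.1 - q.1)) by ring.
    by rewrite normrN normrM ger0_norm// (le_lt_trans _ q1)// ler_piMl.
  have -> : (1 - t) * p.2 + t * q.2 - p.2 = - (t * (p.2 - q.2)) by ring.
  by rewrite normrN normrM ger0_norm// (le_lt_trans _ q2)// ler_piMl.
- exists 0; first by rewrite /= in_itv/= lexx ler01.
  by rewrite /seg_pt /= subr0 !mul1r !mul0r !addr0 -surjective_pairing.
- exists 1; first by rewrite /= in_itv/= lexx ler01.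
  by rewrite /seg_pt /= subrr !mul1r !mul0r !add0r -surjective_pairing.
Qed.

(** * Euclidean distances, edges and vertices *)

Lemma edist2_ge0 (R : realType) (p q : R * R) : 0 <= edist2 p q.
Proof. exact: sqrtr_ge0. Qed.

Lemma edist2_le (R : realType) (p q : R * R) : edist2 p q <= `|p.1 - q.1| + `|p.2 - q.2|.
Proof.
rewrite /edist2 -[leRHS]ger0_norm ?addr_ge0// -sqrtr_sqr ler_wsqrtr//.
rewrite -[(p.1 - q.1) ^+ 2]real_normK ?num_real// -[(p.2 - q.2) ^+ 2]real_normK ?num_real//.
rewrite sqrrD; have := mulr_ge0 (normr_ge0 (p.1 - q.1)) (normr_ge0 (p.2 - q.2)); lra.
Qed.

Lemma edist2_ge1 (R : realType) (p q : R * R) : `|p.1 - q.1| <= edist2 p q.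
Proof. by rewrite /edist2 -sqrtr_sqr ler_wsqrtr// lerDl sqr_ge0. Qed.

Lemma edist2_ge2 (R : realType) (p q : R * R) : `|p.2 - q.2| <= edist2 p q.
Proof. by rewrite /edist2 -sqrtr_sqr ler_wsqrtr// lerDr sqr_ge0. Qed.

Lemma edist_to_le (R : realType) (p q : R * R) (A : set (R * R)) : A q -> edist_to p A <= edist2 p q.
Proof.
move=> Aq; apply: ge_inf; last by exists q.
by exists 0 => _ [z _ <-]; exact: edist2_ge0.
Qed.

(** A positive diameter cannot be the default value 0 of [sup], so the distances are bounded. *)
Lemma ediam_ge (R : realType) (A : set (R * R)) p q :
  0 < ediam A -> A p -> A q -> edist2 p q <= ediam A.
Proof.
move=> A0 Ap Aq; apply: sup_upper_bound; last by exists (p, q).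
by apply: contrapT => /sup_out; rewrite -/(ediam A) => AE; move: A0; rewrite AE ltxx.
Qed.

Lemma seg_left (R : realType) (e : (R * R) * (R * R)) : seg e e.1.
Proof.
exists 0; first by rewrite /= in_itv/= lexx ler01.
by rewrite /seg_pt /= subr0 !mul1r !mul0r !addr0 -surjective_pairing.
Qed.

Lemma seg_right (R : realType) (e : (R * R) * (R * R)) : seg e e.2.
Proof.
exists 1; first by rewrite /= in_itv/= lexx ler01.
by rewrite /seg_pt /= subrr !mul1r !mul0r !add0r -surjective_pairing.
Qed.

Lemma seg_convex (R : realType) (e : (R * R) * (R * R)) p q (t : R) :
  seg e p -> seg e q -> 0 <= t <= 1 -> seg e (seg_pt (p, q) t).
Proof.
move=> [a /=]; rewrite in_itv/= => /andP[a0 a1] <-.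
move=> [b /=]; rewrite in_itv/= => /andP[b0 b1] <- /andP[t0 t1].
exists ((1 - t) * a + t * b).
  by rewrite /= in_itv/=; apply/andP; split; nra.
by rewrite /seg_pt /=; congr pair; ring.
Qed.

Lemma edges_mem (R : realType) (s : seq (R * R)) e : e \in edges s -> e.1 \in s /\ e.2 \in s.
Proof.
move=> es; split.
  by apply: (mem_subseq (subseq_refl s)); have := map_f fst es; rewrite -/(unzip1 _) unzip1_zip ?size_rot.
by have := map_f snd es; rewrite -/(unzip2 _) unzip2_zip ?size_rot// mem_rot.
Qed.

Lemma edge_from (R : realType) (s : seq (R * R)) v : simple_polygon s -> v \in s ->
  exists2 w, (v, w) \in edges s & w != v.
Proof.
move=> [s2 us _] vs; pose i := index v s; have is_ : (i < size s)%N by rewrite index_mem.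
pose w := nth v (rot 1 s) i.
have vw : (v, w) \in edges s.
  have -> : (v, w) = nth (v, v) (zip s (rot 1 s)) i by rewrite nth_zip ?size_rot// nth_index.
  by rewrite mem_nth// size_zip size_rot minnn.
exists w => //; rewrite /w /rot nth_cat size_drop.
have [ltn|gen] := ltnP i (size s - 1).
  rewrite nth_drop -[X in _ != X](nth_index v vs) nth_uniq//; first by rewrite -/i add1n neq_ltn ltnSn orbT.
  by rewrite add1n; move: ltn; rewrite ltn_subRL add1n.
(* Here v is the last vertex, and its successor wraps round to the first. *)
have -> : (i - (size s - 1) = 0)%N by apply/eqP; rewrite subn_eq0; rewrite leq_subRL ?add1n// (ltn_trans _ s2).
rewrite nth_take// -[X in _ != X](nth_index v vs) nth_uniq//; last by rewrite (ltn_trans _ s2).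
by rewrite -/i neq_ltn (leq_trans _ gen)// subn_gt0 (ltn_trans _ s2).
Qed.

(* (A2)-(A9) for a single polygon; the last clause, a consequence of (A2), (A3),
   (A5) and (A6) for large i, says that e contains the interval [-cv, cv]. *)
Definition vertex_gap (R : realType) (s : seq (R * R)) (v : R * R) (e : (R * R) * (R * R)) (cv : R) :=
  [/\ simple_polygon s, v \in s /\ e \in edges s, v != e.1 /\ v != e.2,
      seg e `<=` [set p | p.2 = 0] /\ (v.1 = 0 /\ 0 < v.2) &
   [/\ cv < edist2 (0, 0) e.1 /\ cv < edist2 (0, 0) e.2,
      (forall va, va \in s -> va != v -> cv < edist2 v va),
      (forall ea, ea \in edges s -> ea != e -> v != ea.1 -> v != ea.2 ->
         cv < edist_to v (seg ea)),
      seg (v, (0, 0)) `<=` poly_region s &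
      (forall x, `|x| <= cv -> seg e (x, 0))]].

Definition incident (R : realType) (v : R * R) (E : (R * R) * (R * R)) := (v == E.1) || (v == E.2).

(** The distance from v to q is at most 2 rho <= cv, so (A8) leaves only e and the edges at v; the
    positive height of q rules out e. *)
Lemma boundary_near_vertex (R : realType) s (v : R * R) e cv rho q :
  vertex_gap s v e cv -> v.2 < rho -> 2 * rho <= cv ->
  poly_boundary s q -> `|q.1| <= rho -> 0 < q.2 <= rho ->
  exists2 E, (E \in edges s) && incident v E & seg E q.
Proof.
move=> [_ _ _ [e0 [v1 v2]] [_ _ A8 _ _]] vr rcv [E Es Eq] q1 /andP[q2 q3].
have [Ee|Ene] := eqVneq E e.
  by move: q2; rewrite (e0 q) ?ltxx// -Ee.
exists E => //; rewrite Es /= /incident; apply: contraT; rewrite negb_or => /andP[n1 n2].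
have := A8 E Es Ene n1 n2; rewrite ltNge => /negP; case.
apply: le_trans (edist_to_le _ Eq) _; apply: le_trans (edist2_le _ _) _.
rewrite v1 sub0r normrN; apply: le_trans rcv; rewrite mulr2n mulrDl mul1r lerD//.
by rewrite ler_norml; apply/andP; split; lra.
Qed.

Lemma incident_seg (R : realType) (v : R * R) E : incident v E -> seg E v.
Proof. by case/orP => /eqP ->; [exact: seg_left|exact: seg_right]. Qed.

(** Otherwise the segment from v to q would cross the x-axis at a point of abscissa at most cv in
    absolute value, hence on e. By simplicity this would be an endpoint of e, but those are farther
    than cv from the origin. *)
Lemma incident_pos (R : realType) s (v : R * R) e cv E q :
  vertex_gap s v e cv -> E \in edges s -> incident v E -> seg E q -> `|q.1| <= cv -> 0 < q.2.
Proof.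
move=> [[_ _ smp] [_ es] [n1 n2] [e0 [v1 v2]] [[A51 A52] _ _ _ ecv]] Es iE Eq q1.
have Ene : E != e.
  by apply: contraTN iE => /eqP ->; rewrite /incident negb_or n1.
rewrite ltNge; apply/negP => q2.
have vq : 0 < v.2 - q.2 by lra.
(* The parameter at which the segment from v to q reaches height 0. *)
pose th := v.2 / (v.2 - q.2).
have th1 : 0 <= th <= 1.
  by rewrite /th divr_ge0 ?(ltW v2) ?(ltW vq)//= ler_pdivrMr// mul1r; lra.
have Ez := seg_convex (incident_seg iE) Eq th1.
have zE : seg_pt (v, q) th = (th * q.1, 0).
  by rewrite /seg_pt /= v1 mulr0 add0r; congr pair; rewrite /th; field; rewrite gt_eqF.
rewrite zE in Ez.
have z1 : `|th * q.1| <= cv.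
  case/andP: th1 => t0 t1; rewrite normrM ger0_norm//; apply: le_trans q1.
  by rewrite ler_piMl.
have [_] := smp E e Es es Ene _ (conj Ez (ecv _ z1)).
have d0 (p : R * R) : p = (th * q.1, 0) -> edist2 (0, 0) p = `|th * q.1|.
  by move=> ->; rewrite /edist2 /= subrr expr0n addr0 sub0r sqrrN sqrtr_sqr.
rewrite !inE => /orP[/eqP ze|/eqP ze].
  by move: A51; rewrite -ze d0// ltNge z1.
by move: A52; rewrite -ze d0// ltNge z1.
Qed.

(** Intermediate values along the edge leaving v: it starts inside the square because v.2 < r and
    ends outside because (A7) puts w farther than cv >= 2 r from v. The height needs no absolute
    value, being positive wherever |x| <= cv. *)
Lemma incident_crossing (R : realType) s (v : R * R) e cv r :
  vertex_gap s v e cv -> v.2 < r -> 2 * r <= cv ->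
  exists q, [/\ poly_boundary s q, Num.max `|q.1| q.2 = r & 0 < q.2].
Proof.
move=> gap vr rcv; have [smp [vs es] _ [e0 [v1 v2]] [_ A7 _ _ _]] := gap.
have r0 : 0 < r by apply: lt_trans vr.
have [w Ew wv] := edge_from smp vs.
have [_ /= ws] := edges_mem Ew.
have iE : incident v (v, w) by rewrite /incident eqxx.
pose N (t : R) := Num.max `|(seg_pt (v, w) t).1| (seg_pt (v, w) t).2.
have cN : continuous N.
  move=> t; have h := @seg_pt_continuous R (v, w).
  have c1 : continuous (fun t : R => `|(seg_pt (v, w) t).1| : R).
    move=> x; apply: cvg_norm.
    by apply: (@continuous_comp _ _ _ (seg_pt (v, w)) fst); [exact: h|exact: cvg_fst].
  have c2 : continuous (fun t : R => (seg_pt (v, w) t).2 : R).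
    by move=> x; apply: (@continuous_comp _ _ _ (seg_pt (v, w)) snd); [exact: h|exact: cvg_snd].
  by apply: (@continuous_max _ _ (fun t : R => `|(seg_pt (v, w) t).1| : R) (fun t => (seg_pt (v, w) t).2) t); [exact: c1|exact: c2].
have N0 : N 0 < r.
  by rewrite /N /seg_pt /= subr0 !mul1r !mul0r !addr0 v1 normr0 gt_max r0.
have N1 : r <= N 1.
  rewrite /N /seg_pt /= subrr !mul1r !mul0r !add0r leNgt gt_max; apply/negP => /andP[w1 w2].
  have w0 : 0 < w.2.
    by apply: (incident_pos gap Ew iE (seg_right (v, w))) => /=; lra.
  have := A7 w ws wv; rewrite ltNge => /negP; case.
  apply: le_trans (edist2_le _ _) _; rewrite v1 sub0r normrN.
  apply: le_trans rcv; rewrite mulr2n mulrDl mul1r lerD ?(ltW w1)//.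
  by rewrite ler_norml; apply/andP; split; lra.
have [|c c01 Nc] := @IVT R N 0 1 r ler01 (continuous_subspaceT cN).
  by rewrite ge_min le_max (ltW N0) N1 orbT.
have Eq : seg (v, w) (seg_pt (v, w) c) by exists c.
exists (seg_pt (v, w) c); split => //; first by exists (v, w).
apply: (incident_pos gap Ew iE Eq).
have : `|(seg_pt (v, w) c).1| <= r by rewrite -Nc le_max lexx.
by move=> h; apply: le_trans h _; lra.
Qed.

Lemma gam_onto (R : realType) (r : R) (q : R * R) : 0 < q.2 -> Num.max `|q.1| q.2 = r ->
  exists2 t, 0 < t <= 4 * r & gam r t = q.
Proof.
case: q => x y /= y0 m.
have xr : `|x| <= r by rewrite -m le_max lexx.
have yr : y <= r by rewrite -m le_max lexx orbT.
have r0 : 0 <= r by apply: le_trans xr.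
have /andP[x1 x2] : - r <= x <= r by rewrite -ler_norml.
have [yr'|yr'] := eqVneq y r.
  exists (2 * r - x); first by apply/andP; split; lra.
  rewrite gam_top//; first by congr pair; [ring|].
  by apply/andP; split; lra.
have xr' : `|x| = r by move: m; rewrite /Order.max; case: ifP => // _ /eqP; rewrite (negbTE yr').
have [x0|x0] := leP 0 x.
  have xE : x = r by rewrite -xr' ger0_norm.
  exists y; first by apply/andP; split; lra.
  by rewrite gam_right -?xE// (ltW y0)/= xE.
have xE : x = - r by rewrite -xr' ltr0_norm// opprK.
exists (4 * r - y); first by apply/andP; split; lra.
rewrite gam_left//; first by congr pair; [rewrite xE|ring].
by apply/andP; split; lra.
Qed.

(* The edges at v stay above the x-axis, so by compactness a thin strip above e
   does not meet the boundary. *)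
Lemma boundary_clearance (R : realType) s (v : R * R) e cv rho :
  vertex_gap s v e cv -> v.2 < rho -> 2 * rho <= cv ->
  exists2 m, 0 < m & forall q, `|q.1| <= rho -> 0 < q.2 <= m -> ~ poly_boundary s q.
Proof.
move=> gap vr rcv; have [_ _ _ [_ [v1 v2]] _] := gap.
have rho0 : 0 < rho by lra.
pose K := [set p : R * R | exists2 E, E \in [seq E <- edges s | incident v E] & seg E p] `&`
  cbox ((- rho, rho), (- rho, rho)).
have cK : compact K.
  by apply: compact_closedI; [exact: edges_compact|exact: cbox_closed].
have Kpos q : K q -> 0 < q.2.
  move=> [[E]]; rewrite mem_filter => /andP[iE Es] Eq [/= q1 _].
  apply: (incident_pos gap Es iE Eq); move: q1; rewrite in_itv/= -ler_norml; lra.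
have KI q : poly_boundary s q -> `|q.1| <= rho -> 0 < q.2 <= rho -> K q.
  move=> bq q1 q2; have [E /andP[Es iE] Eq] := boundary_near_vertex gap vr rcv bq q1 q2.
  split; first by exists E; rewrite // mem_filter iE.
  case/andP: q2 => q2 q3; split; first by rewrite /= in_itv/= -ler_norml.
  by rewrite /= in_itv/=; apply/andP; split; lra.
have [K0|Kn] := pselect (K !=set0).
  have [c] := @compact_EVT_min _ R snd K K0 cK (continuous_subspaceT (fun x => cvg_snd)).
  rewrite inE => /Kpos c0 cmin.
  exists (Num.min rho (c.2 / 2)); first by rewrite lt_min rho0 divr_gt0.
  move=> q q1; rewrite le_min => /andP[q0 /andP[q2 q3]] bq.
  have : c.2 <= q.2 by apply: cmin; rewrite inE; apply: KI; rewrite ?q0.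
  by lra.
by exists rho => // q q1 q2 bq; apply: Kn; exists q; exact: KI.
Qed.

(** A first hit exists by compactness, once some hit is known from [incident_crossing]. The open arc
    before it is connected and avoids the boundary, so one interior point on it suffices; that point
    is joined to the segment of (A9) by a horizontal segment just above e. *)
Lemma first_hit (R : realType) s (v : R * R) e cv r :
  vertex_gap s v e cv -> v.2 < r -> 2 * r <= cv ->
  exists t E, [/\ 0 < t <= 4 * r, E \in edges s, incident v E, seg E (gam r t) &
    forall t', 0 < t' < t -> poly_interior s (gam r t')].
Proof.
move=> gap vr rcv; have [_ _ _ [_ [v1 v2]] [_ _ _ A9 _]] := gap.
have r0 : 0 < r by lra.
have [m m0 mclear] := boundary_clearance gap vr rcv.
have [q [bq qr q0]] := incident_crossing gap vr rcv.
have [t0 /andP[t00 t0r] gt0] := gam_onto q0 qr.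
pose m' := Num.min m r.
have m'0 : 0 < m' by rewrite lt_min m0.
have mr : m' <= r by rewrite ge_min lexx orbT.
have mm : m' <= m by rewrite ge_min lexx.
have small t : 0 < t <= m' -> ~ poly_boundary s (gam r t).
  move=> /andP[h1 h2]; rewrite gam_right; last by rewrite (ltW h1)/= (le_trans h2).
  by apply: mclear; rewrite /= ?gtr0_norm// h1 (le_trans h2).
(* The arc starts on the boundary, so the parameter 0 must be discarded; starting at [m'] does this
   and keeps S compact. *)
pose S : set R := `[m', 4 * r] `&` (gam r @^-1` poly_boundary s).
have cS : compact S.
  apply: compact_closedI; first exact: segment_compact.
  apply: closed_comp; first by move=> x _; exact: gam_continuous.
  by apply: compact_closed; [exact: plane_hausdorff|exact: poly_boundary_compact].
have t0lt : t0 < 4 * r.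
  by move: q0; rewrite -gt0 /gam /= !lt_min => /andP[_ /andP[_]]; rewrite subr_gt0.
have St0 : S t0.
  split; last by rewrite /= gt0.
  rewrite /= in_itv/= t0r andbT leNgt; apply/negP => tm.
  by apply: (small t0); rewrite ?gt0// t00 ltW.
have [t] := @compact_EVT_min _ R id S (ex_intro _ t0 St0) cS (continuous_subspaceT (fun x => cvg_id)).
rewrite inE => -[/=]; rewrite in_itv/= => /andP[mt tr] bt tmin.
have tpos : 0 < t by apply: lt_le_trans mt.
have noB t' : 0 < t' < t -> ~ poly_boundary s (gam r t').
  move=> /andP[h1 h2] b'; have [tm|tm] := leP t' m'; first by apply: (small t'); rewrite ?h1.
  have : t <= t'.
    apply: tmin; rewrite inE; split => //=; rewrite in_itv/= (ltW tm)/=; lra.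
  by rewrite leNgt h2.
have gbox u : 0 < u <= 4 * r -> `|(gam r u).1| <= r /\ (gam r u).2 <= r.
  move=> _; rewrite /gam /= ge_min lexx; split => //.
  by rewrite ler_norml le_max lexx /= ge_max ge_min lexx andbT; lra.
(* The other end of the arc, at 4 r, also has height 0; the known hit [t0] < 4 r keeps t away from
   it. *)
have gpos : 0 < (gam r t).2.
  have : t <= t0 by apply: tmin; rewrite inE.
  by move=> h; rewrite /gam /= !lt_min r0 tpos /=; lra.
have [g1 g2] := gbox t (introT andP (conj tpos tr)).
have [E /andP[Es iE] Eg] := boundary_near_vertex gap vr rcv bt g1 (introT andP (conj gpos g2)).
exists t, E; split => //; first by rewrite tpos.
(* A height low enough for three purposes: inside the clear strip, on the segment from v to the
   origin, and reached by the arc before the first hit. *)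
pose y := Num.min (m' / 2) (Num.min v.2 (t / 2)).
have y0 : 0 < y by rewrite !lt_min v2 !divr_gt0.
have ym : y <= m' / 2 by rewrite ge_min lexx.
have yv : y <= v.2 by rewrite !ge_min lexx orbT.
have yt : y <= t / 2 by rewrite !ge_min lexx !orbT.
have hor (x : R) : `|x| <= r -> ~ poly_boundary s (x, y).
  by move=> xr; apply: mclear => //=; rewrite y0/=; lra.
have i0 : poly_interior s (0, y).
  have [] // : poly_region s (0, y).
    apply: A9; exists (1 - y / v.2).
      rewrite /= in_itv/= subr_ge0 ler_pdivrMr// mul1r yv gerBl divr_ge0 ?ltW//.
    by rewrite /seg_pt /= v1 !mulr0 !addr0; congr pair; rewrite opprB addrC subrK divfK ?gt_eqF.
  by move=> /hor; rewrite normr0 => /(_ (ltW r0)).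
have i1 : poly_interior s (r, y).
  apply: (poly_interior_connected i0 (seg_connected (e := ((0, y), (r, y))))).
  - move=> z [a /=]; rewrite in_itv/= => /andP[a0 a1] <-.
    have -> : seg_pt ((0, y), (r, y)) a = (a * r, y) by rewrite /seg_pt /=; congr pair; ring.
    by apply: hor; rewrite normrM !ger0_norm ?(ltW r0)// ler_piMl// ltW.
  - exact: (seg_left ((0, y), (r, y))).
  - exact: (seg_right ((0, y), (r, y))).
move=> t' t't.
apply: (@poly_interior_connected _ _ (gam r @` `]0, t[%classic) (r, y)) => //.
- apply: connected_continuous_connected; last exact: (continuous_subspaceT (gam_continuous (r := r))).
  apply/connected_intervalP; exact: interval_is_interval.
- by move=> z [u /=]; rewrite in_itv/= => /noB h <-.
- exists y; first by rewrite /= in_itv/= y0/=; lra.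
  by rewrite gam_right// (ltW y0)/=; lra.
Qed.

(** * The trace error on the arcs *)

(** The squared trace error. The chord of x^2 stands for the trace, which makes this continuous in t
    over the whole line, while a trace is prescribed on the edges only. *)
Definition edge_err (R : realType) (f : R * R -> R) (E : (R * R) * (R * R)) (t : R) : R :=
  (f (seg_pt E t) - ((1 - t) * xsq E.1 + t * xsq E.2)) ^+ 2.

Lemma edge_err_ge0 (R : realType) (f : R * R -> R) E t : 0 <= edge_err f E t.
Proof. exact: sqr_ge0. Qed.

Lemma edge_err_continuous (R : realType) (f : R * R -> R) E : continuous f -> continuous (edge_err f E).
Proof.
move=> cf.
have c1 : continuous (fun t => f (seg_pt E t) - ((1 - t) * xsq E.1 + t * xsq E.2)).
  move=> t; apply: cvgB.
    by apply: (@continuous_comp _ _ _ (seg_pt E) f); [exact: seg_pt_continuous|exact: cf].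
  apply: cvgD; apply: cvgM; try exact: cvg_cst; last exact: cvg_id.
  by apply: cvgB; [exact: cvg_cst|exact: cvg_id].
by move=> t; exact: (cvgM (c1 t) (c1 t)).
Qed.

(* One term for each side x = r, x = - r, y = r of the square, which an edge
   meets at a parameter that is an affine function of r. *)
Definition bd_err1 (R : realType) (f : R * R -> R) (E : (R * R) * (R * R)) (r : R) : R :=
  edge_term (edge_err f E) (E.2.1 - E.1.1) E.1.1 r +
  edge_term (edge_err f E) (- (E.2.1 - E.1.1)) (- E.1.1) r +
  edge_term (edge_err f E) (E.2.2 - E.1.2) E.1.2 r.

Definition bd_err (R : realType) (f : R * R -> R) (s : seq (R * R)) (r : R) : R :=
  \sum_(E <- edges s) bd_err1 f E r.

Lemma bd_err1_ge0 (R : realType) (f : R * R -> R) E r : 0 <= bd_err1 f E r.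
Proof. by rewrite /bd_err1 !addr_ge0//; apply: edge_term_ge0 => t; exact: edge_err_ge0. Qed.

Lemma bd_err_ge0 (R : realType) (f : R * R -> R) s r : 0 <= bd_err f s r.
Proof. by apply: sumr_ge0 => E _; exact: bd_err1_ge0. Qed.

Lemma measurable_bd_err1 (R : realType) (f : R * R -> R) E :
  continuous f -> measurable_fun setT (bd_err1 f E).
Proof.
move=> cf; apply: measurable_funD; first apply: measurable_funD;
  by apply: measurable_edge_term; exact: edge_err_continuous.
Qed.

Lemma measurable_bd_err (R : realType) (f : R * R -> R) s :
  continuous f -> measurable_fun setT (bd_err f s).
Proof. by move=> cf; apply: measurable_sum => E; exact: measurable_bd_err1. Qed.

Lemma edge_term_at (R : realType) (C : R -> R) (c d t : R) : c != 0 -> 0 <= t <= 1 ->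
  edge_term C c d (c * t + d) = C t.
Proof.
move=> c0 t01; rewrite /edge_term (negbTE c0) addrK mulrAC divff// mul1r.
by rewrite indicE mem_set ?mulr1//= in_itv.
Qed.

(** All terms of [bd_err] are nonnegative, so the one of the side that is hit can be singled out.
    The disequalities exclude edges parallel to that side, where [edge_term] is 0 by default. *)
Lemma bd_err_hit (R : realType) (f : R * R -> R) s E (r t : R) : E \in edges s -> 0 <= t <= 1 ->
  [\/ E.2.1 != E.1.1 /\ (seg_pt E t).1 = r, E.2.1 != E.1.1 /\ (seg_pt E t).1 = - r |
      E.2.2 != E.1.2 /\ (seg_pt E t).2 = r] ->
  edge_err f E t <= bd_err f s r.
Proof.
move=> Es t01 h; apply: (@le_trans _ _ (bd_err1 f E r)); last first.
  by rewrite /bd_err (big_rem E)//= lerDl; apply: sumr_ge0 => E' _; exact: bd_err1_ge0.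
have e0 := edge_err_ge0 f E.
have n1 := edge_term_ge0 (E.2.1 - E.1.1) E.1.1 r e0.
have n2 := edge_term_ge0 (- (E.2.1 - E.1.1)) (- E.1.1) r e0.
have n3 := edge_term_ge0 (E.2.2 - E.1.2) E.1.2 r e0.
rewrite /bd_err1; case: h => -[cN q].
- have := edge_term_at (edge_err f E) (c := E.2.1 - E.1.1) E.1.1 _ t01.
  rewrite subr_eq0 => /(_ cN); rewrite (_ : _ * t + _ = r); first by move=> <-; lra.
  by rewrite -q /seg_pt /=; ring.
- have := edge_term_at (edge_err f E) (c := - (E.2.1 - E.1.1)) (- E.1.1) _ t01.
  rewrite oppr_eq0 subr_eq0 => /(_ cN); rewrite (_ : _ * t + _ = r); first by move=> <-; lra.
  by rewrite -[RHS]opprK -q /seg_pt /=; ring.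
- have := edge_term_at (edge_err f E) (c := E.2.2 - E.1.2) E.1.2 _ t01.
  rewrite subr_eq0 => /(_ cN); rewrite (_ : _ * t + _ = r); first by move=> <-; lra.
  by rewrite -q /seg_pt /=; ring.
Qed.

(** One substitution per side of the square; each Jacobian is a coordinate of the edge vector up to
    sign, hence at most the length of the edge. *)
Lemma integral_bd_err1 (R : realType) (f : R * R -> R) E : continuous f ->
  (\int[lebesgue_measure]_r (bd_err1 f E r)%:E <=
   3%:E * ((edist2 E.1 E.2)%:E * \int[lebesgue_measure]_(t in `[0%R, 1%R]) (edge_err f E t)%:E))%E.
Proof.
move=> cf; have ce := edge_err_continuous (E := E) cf; have e0 := edge_err_ge0 f E.
have m c d : measurable_fun setT (fun r => (edge_term (edge_err f E) c d r)%:E).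
  by apply/measurable_EFinP; exact: measurable_edge_term.
have n c d r : (0 <= (edge_term (edge_err f E) c d r)%:E)%E by rewrite lee_fin; exact: edge_term_ge0.
rewrite /bd_err1; under eq_integral do rewrite !EFinD.
rewrite ge0_integralD; [|by []|by move=> r _; rewrite adde_ge0 ?n
  |by apply: emeasurable_funD; exact: m|by move=> r _; exact: n|exact: m].
rewrite ge0_integralD; [|by []|by move=> r _; exact: n|exact: m|by move=> r _; exact: n|exact: m].
rewrite !edge_term_integral//.
set I := (\int[_]_(_ in _) _)%E.
have I0 : (0 <= I)%E by apply: integral_ge0 => t _; rewrite lee_fin.
have -> : (3%:E = 1 + 1 + 1 :> \bar R)%E by rewrite -!EFinD; congr EFin; ring.
have D0 : (0 <= (edist2 E.1 E.2)%:E * I)%E by rewrite mule_ge0// lee_fin edist2_ge0.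
rewrite ge0_muleDl ?adde_ge0// ge0_muleDl// !mul1e.
have d1 : `|E.2.1 - E.1.1| <= edist2 E.1 E.2 by rewrite distrC; exact: edist2_ge1.
have d2 : `|E.2.2 - E.1.2| <= edist2 E.1 E.2 by rewrite distrC; exact: edist2_ge2.
by rewrite normrN; apply: leeD; first apply: leeD; apply: lee_wpmul2r => //; rewrite lee_fin.
Qed.

(** This is how convergence of traces in L^2 controls values at the ends of the arcs, on average
    over r. *)
Lemma integral_bd_err (R : realType) (f g : R * R -> R) s : continuous f ->
  linear_interpolant s (@xsq R) g ->
  (\int[lebesgue_measure]_r (bd_err f s r)%:E <= 3%:E * L2_boundary_sq s (f \- g)%R)%E.
Proof.
move=> cf lg; rewrite /bd_err; under eq_integral do rewrite -sumEFin.
rewrite ge0_integral_sum//; last 2 first.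
- by move=> E; apply/measurable_EFinP; exact: measurable_bd_err1.
- by move=> E r _; rewrite lee_fin; exact: bd_err1_ge0.
rewrite /L2_boundary_sq ge0_sume_distrr; last first.
  move=> E _; apply: mule_ge0; first by rewrite lee_fin edist2_ge0.
  by apply: integral_ge0 => t _; rewrite lee_fin sqr_ge0.
rewrite big_seq [leRHS]big_seq; apply: lee_sum => E Es.
apply: le_trans (integral_bd_err1 E cf) _.
rewrite le_eqVlt; apply/orP; left; apply/eqP; congr (_ * (_ * _))%E.
apply: eq_integral => t; rewrite inE/= in_itv/= => t01.
by congr EFin; rewrite /edge_err /= (lg E Es t t01).
Qed.

Lemma gam_square (R : realType) (r t : R) : 0 < t <= 4 * r ->
  [\/ (gam r t).1 = r, (gam r t).1 = - r | (gam r t).2 = r].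
Proof.
move=> /andP[t0 t4]; have r0 : 0 <= r by lra.
have [tr|rt] := leP t r; first by apply: Or31; rewrite gam_right// ltW.
have [t3|t3] := leP t (3 * r); first by apply: Or33; rewrite gam_top// ltW.
by apply: Or32; rewrite gam_left// ltW.
Qed.

(* On e, x^2 minus the chord of x^2 equals (x - x1) (x - x2). *)
Lemma base_gap (R : realType) s (v : R * R) e cv f (r : R) :
  vertex_gap s v e cv -> 0 < r -> 2 * r <= cv ->
  exists2 a, xsq (r, 0) - f (r, 0) <= - (cv ^+ 2 / 2) + `|a| & a ^+ 2 <= bd_err f s r.
Proof.
move=> [_ [_ es] _ [e0 _] [[A51 A52] _ _ _ ecv]] r0 rcv.
have cv0 : 0 < cv by lra.
have [y1 y2] : e.1.2 = 0 /\ e.2.2 = 0.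
  by split; apply: e0; [exact: seg_left|exact: seg_right].
have d0 (p : R * R) : p.2 = 0 -> edist2 (0, 0) p = `|p.1|.
  by move=> p0; rewrite /edist2 p0 /= sub0r subrr expr0n addr0 sqrrN sqrtr_sqr.
rewrite d0// in A51; rewrite d0// in A52.
have [t /=] : seg e (r, 0) by apply: ecv; rewrite gtr0_norm//; lra.
rewrite in_itv/= => t01 tE.
have [t' /=] : seg e (0, 0) by apply: ecv; rewrite normr0; lra.
rewrite in_itv/= => /andP[t'0 t'1] t'E.
have tx : (1 - t) * e.1.1 + t * e.2.1 = r by have := congr1 fst tE.
have t'x : (1 - t') * e.1.1 + t' * e.2.1 = 0 by have := congr1 fst t'E.
set x1 := e.1.1 in A51 tx t'x *; set x2 := e.2.1 in A52 tx t'x *.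
(* The origin lies on e and both endpoints are farther than cv from it, so they are on opposite
   sides. *)
have sgn : (x1 < - cv /\ cv < x2) \/ (cv < x1 /\ x2 < - cv).
  move: A51 A52; rewrite !ltr_normr => /orP[a1|a1] /orP[a2|a2].
  - by exfalso; nra.
  - by right; split; lra.
  - by left; split; lra.
  - by exfalso; nra.
exists (f (r, 0) - ((1 - t) * xsq e.1 + t * xsq e.2)); last first.
  have := @bd_err_hit R f s e r t es t01; rewrite /edge_err tE; apply.
  by apply: Or31; split => //; case: sgn => -[? ?]; rewrite -/x1 -/x2 neq_lt; apply/orP; [right|left]; lra.
have : - (f (r, 0) - ((1 - t) * xsq e.1 + t * xsq e.2)) <=
   `|f (r, 0) - ((1 - t) * xsq e.1 + t * xsq e.2)| by rewrite -normrN ler_norm.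
suff : xsq (r, 0) - ((1 - t) * xsq e.1 + t * xsq e.2) <= - (cv ^+ 2 / 2) by lra.
rewrite /xsq /= -/x1 -/x2.
have -> : r ^+ 2 - ((1 - t) * x1 ^+ 2 + t * x2 ^+ 2) = (r - x1) * (r - x2).
  by rewrite -tx; ring.
have -> : (r - x1) * (r - x2) = - ((r - x1) * (x2 - r)) by ring.
(* As 0 < r <= cv / 2, the point r is at distance at least cv from one endpoint and cv / 2 from the
   other. *)
rewrite lerN2; case: sgn => -[s1 s2].
  have : cv * (cv / 2) <= (r - x1) * (x2 - r) by apply: ler_pM; lra.
  by rewrite expr2 mulrA.
have : (cv / 2) * cv <= (x1 - r) * (r - x2) by apply: ler_pM; lra.
rewrite expr2 mulrAC => h; apply: le_trans h _; lra.
Qed.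

Lemma poly_boundary_vertex (R : realType) s (v : R * R) : simple_polygon s -> v \in s -> poly_boundary s v.
Proof.
move=> smp vs; have [w vw _] := edge_from smp vs.
by exists (v, w) => //; exact: (seg_left (v, w)).
Qed.

(* On an edge from v to w the chord of x^2 is theta w.1^2 <= |theta w.1| = |x|,
   as |w.1| <= diam P = 1. *)
Lemma hit_gap (R : realType) s (v : R * R) e cv f (r t : R) E :
  vertex_gap s v e cv -> ediam (poly_region s) = 1 ->
  v.2 < r -> 0 < t <= 4 * r -> E \in edges s -> incident v E -> seg E (gam r t) ->
  exists2 b, - r - `|b| <= xsq (gam r t) - f (gam r t) & b ^+ 2 <= bd_err f s r.
Proof.
move=> [smp _ _ [_ [v1 v2]] _] dm vr t4 Es iE [u /= u01 uE].
rewrite in_itv/= in u01.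
have r0 : 0 < r by lra.
have near x : x \in s -> `|x.1| <= 1.
  move=> xs; have [vs] : v \in s.
    by have [h1 h2] := edges_mem Es; case/orP: iE => /eqP ->.
  have : edist2 x v <= 1.
    by rewrite -dm; apply: ediam_ge; rewrite ?dm//; right; exact: poly_boundary_vertex.
  by apply: le_trans; have := edist2_ge1 x v; rewrite v1 subr0.
exists (f (gam r t) - ((1 - u) * xsq E.1 + u * xsq E.2)); last first.
  have := @bd_err_hit R f s E r u Es u01; rewrite /edge_err uE; apply.
  (* An edge at v that is vertical lies on x = 0, and a horizontal one at height v.2 < r; so neither
     is parallel to the side that it hits. *)
  have gx : E.2.1 = E.1.1 -> (gam r t).1 = 0.
    move=> h; rewrite -uE /seg_pt /= h -mulrDl subrK mul1r.
    by case/orP: iE => /eqP vE; [rewrite -vE|rewrite -h -vE].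
  have gy : E.2.2 = E.1.2 -> (gam r t).2 = v.2.
    move=> h; rewrite -uE /seg_pt /= h -mulrDl subrK mul1r.
    by case/orP: iE => /eqP ->.
  case: (gam_square t4) => h; [apply: Or31|apply: Or32|apply: Or33]; split => //; apply/eqP.
  - by move/gx; rewrite h; lra.
  - by move/gx; rewrite h; lra.
  - by move/gy; rewrite h; lra.
have : f (gam r t) - ((1 - u) * xsq E.1 + u * xsq E.2) <=
   `|f (gam r t) - ((1 - u) * xsq E.1 + u * xsq E.2)| by rewrite ler_norm.
suff : - r <= xsq (gam r t) - ((1 - u) * xsq E.1 + u * xsq E.2) by lra.
have xr : `|(gam r t).1| <= r.
  by rewrite /gam /= ler_norml le_max lexx /= ge_max ge_min lexx andbT; lra.
have [p1 p2] := edges_mem Es.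
have /andP[u0 u1] := u01.
have key th (x : R) : `|x| <= 1 -> 0 <= th -> `|th * x| <= r -> - r <= (th * x) ^+ 2 - th * x ^+ 2.
  move=> x1 th0 thx; have : th * x ^+ 2 <= r.
    rewrite -[x ^+ 2]real_normK ?num_real// expr2 mulrA.
    rewrite normrM ger0_norm// in thx; apply: le_trans thx.
    by rewrite ler_piMr// mulr_ge0.
  by have := sqr_ge0 (th * x); lra.
rewrite /xsq -uE /seg_pt /=; rewrite -uE /seg_pt /= in xr.
case/orP: iE => /eqP vE; rewrite vE in v1; rewrite v1 !mulr0 in xr *.
  rewrite add0r in xr *; rewrite expr0n mulr0 add0r; apply: key => //; exact: near.
rewrite addr0 in xr *; rewrite expr0n mulr0 addr0; apply: key => //; [exact: near|lra].
Qed.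

(** The lower bound h on the radius makes the coefficient of the trace error independent of r, ready
    for integration. *)
Lemma arc_lower_bound (R : realType) s (v : R * R) e cv f (h r : R) :
  vertex_gap s v e cv -> ediam (poly_region s) = 1 -> 0 < cv -> smooth f ->
  0 < h -> v.2 < r -> h <= r -> 2 * r <= cv -> 4 * r <= cv ^+ 2 ->
  (((cv ^+ 2 / 4) ^+ 2 / 16 / r)%:E <=
    col_energy (poly_interior s) (@xsq R \- f)%R r + row_energy (poly_interior s) (@xsq R \- f)%R r +
    col_energy (poly_interior s) (@xsq R \- f)%R (- r) + ((2 * h)^-1 * bd_err f s r)%:E)%E.
Proof.
move=> gap dm cv0 sf h0 vr hr rcv rcv2.
have r0 : 0 < r by lra.
have [t [E [t4 Es iE Eg int]]] := first_hit gap vr rcv.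
have [a a1 a2] := base_gap f gap r0 rcv.
have [b b1 b2] := hit_gap f gap dm vr t4 Es iE Eg.
have mO := open_measurable2 (@poly_interior_open R s).
have hf := smooth_C1 (smoothB (@smooth_xsq R) sf).
pose K := cv ^+ 2 / 4.
have K0 : 0 < K by rewrite divr_gt0// exprn_gt0.
(* AM-GM, which trades |a| for the square-integrable error a^2. *)
have am (x : R) : `|x| <= K / 4 + x ^+ 2 / K.
  rewrite -subr_ge0; have -> : K / 4 + x ^+ 2 / K - `|x| = (`|x| - K / 2) ^+ 2 / K.
    rewrite -[x ^+ 2]real_normK ?num_real//; field; exact: lt0r_neq0.
  by rewrite divr_ge0 ?sqr_ge0// ltW.
have B0 := bd_err_ge0 f s r.
set B := bd_err f s r in a2 b2 B0 *.
have aK : `|a| <= K / 4 + B / K.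
  by apply: le_trans (am a) _; rewrite lerD2l ler_wpM2r// invr_ge0 ltW.
have bK : `|b| <= K / 4 + B / K.
  by apply: le_trans (am b) _; rewrite lerD2l ler_wpM2r// invr_ge0 ltW.
have KE : cv ^+ 2 = 4 * K by rewrite /K; field.
(* The gap 2 K on e, less r <= K at the far end, less two errors of at most K / 4 + B / K each. *)
have diff : K / 2 - 2 * (B / K) <= (@xsq R \- f) (gam r t) - (@xsq R \- f) (r, 0).
  move: a1 b1; rewrite KE /=; rewrite KE in rcv2; lra.
(* The slope K / (8 r) maximizes 2 l (K / 2) - 4 r l^2, with maximum K^2 / (16 r). *)
have l0 : 0 <= K / (8 * r) by rewrite divr_ge0 ?mulr_ge0 ?(ltW K0)// ltW.
have := @arc_energy R (poly_interior s) (@xsq R \- f) r t (K / (8 * r)) mO hf r0 t4 int.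
set A := (col_energy _ _ _ + _ + _)%E => hA.
have : ((K ^+ 2 / 16 / r - (2 * r)^-1 * B)%:E <= A)%E.
  apply: le_trans hA; rewrite lee_fin.
  have : 2 * (K / (8 * r)) * (K / 2 - 2 * (B / K)) <=
     2 * (K / (8 * r)) * ((@xsq R \- f) (gam r t) - (@xsq R \- f) (r, 0)).
    by apply: ler_wpM2l diff; rewrite mulr_ge0.
  have -> : 2 * (K / (8 * r)) * (K / 2 - 2 * (B / K)) = K ^+ 2 / 8 / r - (2 * r)^-1 * B.
    by field; rewrite !gt_eqF.
  have -> : (K / (8 * r)) ^+ 2 * (4 * r) = K ^+ 2 / 16 / r by field; rewrite gt_eqF.
  have -> : K ^+ 2 / 16 / r = (K ^+ 2 / 8 / r) / 2 by field; rewrite gt_eqF.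
  lra.
move=> h1; have := leeD h1 (lexx ((2 * h)^-1 * B)%:E).
apply: le_trans; rewrite -EFinD lee_fin -/K -addrA lerDl addrC subr_ge0 ler_wpM2r//.
by rewrite lef_pV2 ?posrE ?mulr_gt0// ler_pM2l.
Qed.

(** * The energy bound *)

Lemma Hseminorm_sq_ge0 (R : realType) (O : set (R * R)) m (w : R * R -> R) : (0 <= Hseminorm_sq O m w)%E.
Proof. by apply: integral_ge0 => p _; rewrite lee_fin; apply: sumr_ge0 => k _; exact: sqr_ge0. Qed.

Lemma Hseminorm_le_Hnorm (R : realType) (O : set (R * R)) (w : R * R -> R) :
  (Hseminorm_sq O 1 w <= Hnorm_sq O 1 w)%E.
Proof. by rewrite /Hnorm_sq !big_ord_recr big_ord0 /= add0e leeDr// Hseminorm_sq_ge0. Qed.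

(** A neighbour of v is farther than cv from it, within diameter 1. Consequently 4 r <= cv^2 also
    ensures 2 r <= cv. *)
Lemma vertex_gap_le1 (R : realType) s (v : R * R) e cv :
  vertex_gap s v e cv -> ediam (poly_region s) = 1 -> cv <= 1.
Proof.
move=> [smp [vs _] _ _ [_ A7 _ _ _]] dm; have [w vw wv] := edge_from smp vs.
have [_ /= ws] := edges_mem vw.
apply: le_trans (ltW (A7 w ws wv)) _; rewrite -dm.
by apply: ediam_ge; rewrite ?dm//; right; exact: poly_boundary_vertex.
Qed.

Lemma poly_interior_box (R : realType) s (v : R * R) :
  simple_polygon s -> v \in s -> ediam (poly_region s) = 1 ->
  poly_interior s `<=` cbox ((v.1 - 1, v.1 + 1), (v.2 - 1, v.2 + 1)).
Proof.
move=> smp vs dm p ip.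
have : edist2 p v <= 1.
  rewrite -dm; apply: ediam_ge; rewrite ?dm//; first by left.
  by right; exact: poly_boundary_vertex.
move=> h; have := le_trans (edist2_ge1 p v) h; have := le_trans (edist2_ge2 p v) h.
by rewrite !ler_distl => h1 h2; split; rewrite /= in_itv.
Qed.

(** The interior lies in a square of side 2 centred at v. A point on an arc of radius cv / 2 shows
    that it is open and nonempty, so the denominator of the quotient is not 0. *)
Lemma poly_interior_measure (R : realType) s (v : R * R) e cv :
  vertex_gap s v e cv -> ediam (poly_region s) = 1 -> 2 * v.2 < cv ->
  exists2 m, 0 < m <= 4 & leb2 R (poly_interior s) = m%:E.
Proof.
move=> gap dm vcv; have [smp [vs _] _ _ _] := gap.
have iO := @poly_interior_open R s; have mO := open_measurable2 iO.
have le4 : (leb2 R (poly_interior s) <= 4%:E)%E.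
  apply: (@le_trans _ _ (leb2 R (cbox ((v.1 - 1, v.1 + 1), (v.2 - 1, v.2 + 1))))).
    apply: le_measure; rewrite ?inE//; [exact: cbox_measurable|exact: poly_interior_box].
  rewrite leb2_cbox; [|lra|lra]; rewrite lee_fin.
  by rewrite le_eqVlt; apply/orP; left; apply/eqP; ring.
have vr : v.2 < cv / 2 by lra.
have cv2 : 2 * (cv / 2) <= cv by lra.
have [t [E [/andP[t0 _] _ _ _ int]]] := first_hit gap vr cv2.
have ip : poly_interior s (gam (cv / 2) (t / 2)) by apply: int; apply/andP; split; lra.
set p := gam _ _ in ip.
have [d d0 dA] := nbhs_obox (open_nbhs_nbhs (conj iO ip)).
have box_le : (((d + d) ^+ 2)%:E <= leb2 R (poly_interior s))%E.
  have -> : ((d + d) ^+ 2)%:E = leb2 R (obox ((p.1 - d, p.1 + d), (p.2 - d, p.2 + d))).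
    by rewrite leb2_obox; [congr EFin; ring|lra|lra].
  apply: le_measure; rewrite ?inE//; first exact: obox_measurable.
  move=> q [/=]; rewrite !in_itv/= => /andP[q1 q2] /andP[q3 q4].
  by apply: dA; rewrite ltr_distl; apply/andP; split.
have fin : leb2 R (poly_interior s) \is a fin_num.
  by rewrite ge0_fin_numE// (le_lt_trans le4)// ltry.
exists (fine (leb2 R (poly_interior s))); last by rewrite fineK.
rewrite -lte_fin -lee_fin fineK// le4 andbT; apply: lt_le_trans box_le.
by rewrite lte_fin exprn_gt0// addr_gt0.
Qed.

Lemma mule3_2D (R : realDomainType) (x y : \bar R) : (0 <= x)%E -> (0 <= y)%E ->
  (3%:E * (2%:E * x + 2%:E * y) <= 6%:E * x + 6%:E * y)%E.
Proof.
move=> x0 y0; rewrite ge0_muleDr; try by rewrite mule_ge0// lee_fin.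
have E6 (z : \bar R) : (3%:E * (2%:E * z) = 6%:E * z)%E.
  by rewrite muleA -EFinM; congr (_%:E * _)%E; ring.
by rewrite (E6 x) (E6 y).
Qed.

Lemma le_of_vanishing (R : realType) (x y : \bar R) (a b : R) (f g : nat -> \bar R) :
  f k @[k --> \oo] --> 0%E -> g k @[k --> \oo] --> 0%E ->
  (forall k, (x <= y + (a%:E * f k + b%:E * g k))%E) -> (x <= y)%E.
Proof.
move=> f0 g0 bnd.
have lim : (y + (a%:E * f k + b%:E * g k))%E @[k --> \oo] --> (y + (a%:E * 0 + b%:E * 0))%E.
  apply: cvgeD; first by rewrite !mule0 adde0 fin_num_adde_defl.
    exact: cvg_cst.
  apply: cvgeD; first by rewrite !mule0.
    exact: cvgeZl.
  exact: cvgeZl.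
rewrite !mule0 !adde0 in lim.
by apply: cvge_ge lim; apply: nearW.
Qed.

(** The errors of the k-th approximation carry coefficients that depend on v.2 but not on k, so they
    disappear in the limit for this one polygon. The factor 6 is 3 from the three sides times 2 from
    the comparison of energies. *)
Lemma gap_energy (R : realType) s (v : R * R) e cv w :
  vertex_gap s v e cv -> ediam (poly_region s) = 1 -> 0 < cv -> 8 * v.2 < cv ^+ 2 ->
  harmonic_interpolant s (@xsq R) w ->
  (Hseminorm_sq (poly_interior s) 1 (@xsq R \- w)%R < +oo)%E /\
  (((cv ^+ 2 / 4) ^+ 2 / 16 * (ln (cv ^+ 2 / 4) - ln (2 * v.2)))%:E <=
   6%:E * Hseminorm_sq (poly_interior s) 1 (@xsq R \- w)%R)%E.
Proof.
move=> gap dm cv0 v8 [sw _ [g lg [f [sf fH fL]]]].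
have [smp [vs _] _ [_ [_ v2]] _] := gap.
have cv1 := vertex_gap_le1 gap dm.
have cvsq : cv ^+ 2 <= cv by rewrite expr2 ler_piMr// ltW.
set O := poly_interior s in fH sw *.
have iO : open O by exact: poly_interior_open.
have mO := open_measurable2 iO.
have OK : O `<=` cbox ((v.1 - 1, v.1 + 1), (v.2 - 1, v.2 + 1)) by exact: poly_interior_box.
pose D := Hseminorm_sq O 1 (@xsq R \- w); pose err k := Hseminorm_sq O 1 (f k \- w).
have apx k := Hseminorm1_approx iO (@cbox_compact _ _) OK (@smooth_xsq R) (sf k) sw.
have err0 : err k @[k --> \oo] --> 0%E.
  apply: (@squeeze_cvge _ _ _ _ (cst 0%E) _ (fun k => Hnorm_sq O 1 (f k \- w))) => //.
  - by apply: nearW => k; rewrite Hseminorm_sq_ge0 Hseminorm_le_Hnorm.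
  - exact: cvg_cst.
have Dfin : (D < +oo)%E.
  (* Convergence to 0 makes the error finite from some index on; a single such approximation already
     bounds D. *)
  have /fine_cvgP[[N _ hN] _] := err0.
  have [_ h2 h3] := apx N.
  have e1 : (err N < +oo)%E by rewrite -ge0_fin_numE ?Hseminorm_sq_ge0//; exact: (hN N (leqnn N)).
  apply: le_lt_trans h2 _; apply: lte_add_pinfty; apply: lte_mul_pinfty => //; by rewrite lee_fin.
split=> //.
(* The error coefficient for radii from h = 2 v.2 on, a start that keeps r strictly above v.2. *)
pose c := (2 * (2 * v.2))^-1.
have c0 : 0 <= c by rewrite invr_ge0 !mulr_ge0// ltW.
have bound k : (((cv ^+ 2 / 4) ^+ 2 / 16 * (ln (cv ^+ 2 / 4) - ln (2 * v.2)))%:E <=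
   6%:E * D + (6%:E * err k + (c * 3)%:E * L2_boundary_sq s (f k \- g)%R))%E.
  have hf := smooth_C1 (smoothB (@smooth_xsq R) (sf k)).
  have cf := smooth_continuous (sf k).
  have := @log_energy R O (@xsq R \- f k) (bd_err (f k) s) ((cv ^+ 2 / 4) ^+ 2 / 16)
    (2 * v.2) (cv ^+ 2 / 4) c mO hf _ _ c0 (measurable_bd_err s cf) (bd_err_ge0 (f k) s).
  move=> h; apply: le_trans (h _ _ _ _) _.
  - by rewrite mulr_gt0.
  - lra.
  - move=> r /andP[r1 r2]; apply: (arc_lower_bound gap dm cv0 (sf k)) => //; lra.
  - by rewrite divr_ge0// sqr_ge0.
  rewrite addeA; apply: leeD.
    have [h1 _ _] := apx k.
    apply: le_trans (lee_wpmul2l _ h1) _; first by rewrite lee_fin.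
    exact/mule3_2D/Hseminorm_sq_ge0/Hseminorm_sq_ge0.
  apply: le_trans (lee_wpmul2l _ (integral_bd_err cf lg)) _; first by rewrite lee_fin.
  by rewrite muleA -EFinM.
exact: le_of_vanishing err0 fL bound.
Qed.

(** Closeness of v to e is needed for the last clause: it yields a point of e with abscissa in ]-
    cv, cv[, so the endpoints, both beyond cv, lie on opposite sides. *)
Lemma vertex_gapP (R : realType) s (v : R * R) e cv :
  0 < cv -> simple_polygon s -> v \in s -> e \in edges s -> v != e.1 /\ v != e.2 ->
  seg e `<=` [set p | p.2 = 0] -> v.1 = 0 /\ 0 < v.2 ->
  cv < edist2 (0, 0) e.1 /\ cv < edist2 (0, 0) e.2 ->
  (forall va, va \in s -> va != v -> cv < edist2 v va) ->
  (forall ea, ea \in edges s -> ea != e -> v != ea.1 -> v != ea.2 -> cv < edist_to v (seg ea)) ->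
  seg (v, (0, 0)) `<=` poly_region s -> edist_to v (seg e) < cv ->
  vertex_gap s v e cv.
Proof.
move=> cv0 smp vs es ve e0 [v1 v2] [A51 A52] A7 A8 A9 dist; split => //; split => // x xcv.
have [y1 y2] : e.1.2 = 0 /\ e.2.2 = 0.
  by split; apply: e0; [exact: seg_left|exact: seg_right].
have d0 (p : R * R) : p.2 = 0 -> edist2 (0, 0) p = `|p.1|.
  by move=> p0; rewrite /edist2 p0 /= sub0r subrr expr0n addr0 sqrrN sqrtr_sqr.
rewrite d0// in A51; rewrite d0// in A52.
have [|d [q [t /=]]] := @inf_lt R [set edist2 v q | q in seg e] cv _ dist.
  by exists (edist2 v e.1); exists e.1 => //; exact: seg_left.
rewrite in_itv/= => /andP[t0 t1] qE <- dcv.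
have := le_lt_trans (edist2_ge1 v q) dcv; rewrite v1 sub0r normrN -qE /seg_pt /=.
move: xcv; rewrite ler_norml ltr_norml => /andP[x1 x2] /andP[q1 q2].
set a := e.1.1 in A51 q1 q2; set b := e.2.1 in A52 q1 q2.
have sgn : (a < - cv /\ cv < b) \/ (cv < a /\ b < - cv).
  move: A51 A52; rewrite !ltr_normr => /orP[a1|a1] /orP[a2|a2].
  - by exfalso; nra.
  - by right; split; lra.
  - by left; split; lra.
  - by exfalso; nra.
have ba : b - a != 0 by case: sgn => -[? ?]; rewrite neq_lt; apply/orP; [right|left]; lra.
exists ((x - a) / (b - a)).
  rewrite /= in_itv/=; case: sgn => -[s1 s2].
    by rewrite divr_ge0 ?ler_pdivrMr//=; lra.
  have -> : (x - a) / (b - a) = (a - x) / (a - b) by rewrite -[RHS]mulrNN -invrN !opprB.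
  by rewrite divr_ge0 ?ler_pdivrMr//=; lra.
rewrite /seg_pt /= y1 y2 !mulr0 addr0 -/a -/b; congr pair.
by field.
Qed.

Theorem lemma4p5 (R : realType)
  (P : nat -> seq (R * R)) (v : nat -> R * R) (e : nat -> (R * R) * (R * R))
  (P_simple : forall i, simple_polygon (P i))
  (v_vertex : forall i, v i \in P i)
  (e_edge : forall i, e i \in edges (P i))
  (not_incident : forall i, v i != (e i).1 /\ v i != (e i).2)
  (cv : R) (cv_gt0 : 0 < cv)
  (A1 : forall i, ediam (poly_region (P i)) = 1)
  (A2 : forall i, seg (e i) `<=` [set p | p.2 = 0])
  (A3 : forall i, (v i).1 = 0 /\ 0 < (v i).2)
  (A5 : forall i, cv < edist2 (0, 0) (e i).1 /\ cv < edist2 (0, 0) (e i).2)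
  (A6 : edist_to (v i) (seg (e i)) @[i --> \oo] --> (0 : R))
  (A7 : forall i va, va \in P i -> va != v i -> cv < edist2 (v i) va)
  (A8 : forall i ea, ea \in edges (P i) -> ea != e i ->
     v i != ea.1 -> v i != ea.2 -> cv < edist_to (v i) (seg ea))
  (A9 : forall i, seg (v i, (0, 0)) `<=` poly_region (P i))
  (u : R * R -> R) (u_def : forall x y, u (x, y) = x ^+ 2)
  (Iu : nat -> R * R -> R)
  (Iu_def : forall i, harmonic_interpolant (P i) u (Iu i)) :
  Hseminorm (poly_interior (P i)) 1 (u \- Iu i) /
  Hseminorm (poly_interior (P i)) 2 u @[i --> \oo] --> +oo.
Proof.
have uE : u = @xsq R by apply/funext => -[x y]; rewrite u_def.
rewrite uE in Iu_def *.
pose rho := cv ^+ 2 / 4; pose K := rho ^+ 2 / 16.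
have rho0 : 0 < rho by rewrite divr_gt0// exprn_gt0.
have K0 : 0 < K by rewrite divr_gt0// exprn_gt0.
apply/cvgryPge => A.
(* Chosen so that ln rho - ln (2 v.2) >= 96 A^2 / K. Then 6 |u - I_P u|^2 >= 96 A^2, and 96 = 6 * 16
   matches |u|^2 = 4 m <= 16 in the denominator. *)
pose eta := rho * expR (- (96 * A ^+ 2 / K)) / 2.
have eta0 : 0 < eta by rewrite divr_gt0// mulr_gt0// expR_gt0.
near=> i.
have dcv : edist_to (v i) (seg (e i)) < cv by near: i; exact: (cvgr_lt _ A6).
have deta : edist_to (v i) (seg (e i)) < eta by near: i; exact: (cvgr_lt _ A6).
have gap := vertex_gapP cv_gt0 (P_simple i) (v_vertex i) (e_edge i) (not_incident i) (A2 i)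
  (A3 i) (A5 i) (A7 i) (A8 i) (A9 i) dcv.
have [v1 v2] := A3 i.
(* As e lies on the x-axis, every point of it is at least v.2 away, so (A6) forces the height of v
   to 0. *)
have hd : (v i).2 <= edist_to (v i) (seg (e i)).
  apply: lb_le_inf; first by exists (edist2 (v i) (e i).1); exists (e i).1 => //; exact: seg_left.
  move=> _ [q qe <-]; have q0 := A2 i q qe.
  by apply: le_trans (edist2_ge2 _ _); rewrite q0 subr0 ler_norm.
have h2 : 2 * (v i).2 < rho * expR (- (96 * A ^+ 2 / K)).
  by have := le_lt_trans hd deta; rewrite /eta; lra.
have h3 : 2 * (v i).2 < rho.
  apply: lt_le_trans h2 _; rewrite ler_piMr ?(ltW rho0)// -[leRHS]expR0 ler_expR oppr_le0.
  by rewrite divr_ge0 ?(ltW K0)// mulr_ge0// sqr_ge0.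
have cv1 := vertex_gap_le1 gap (A1 i).
have cvsq : cv ^+ 2 <= cv by rewrite expr2 ler_piMr// ltW.
have h8 : 8 * (v i).2 < cv ^+ 2 by move: h3; rewrite /rho; lra.
have hcv : 2 * (v i).2 < cv by lra.
have [Dfin Dge] := gap_energy gap (A1 i) cv_gt0 h8 (Iu_def i).
have [m /andP[m0 m4] mE] := poly_interior_measure gap (A1 i) hcv.
rewrite /Hseminorm (Hseminorm_sq2_xsq (@poly_interior_open R (P i))) mE -EFinM /=.
set D := Hseminorm_sq _ _ _ in Dfin Dge *.
have D0 : (0 <= D)%E by exact: Hseminorm_sq_ge0.
have DE : D = (fine D)%:E by rewrite fineK// ge0_fin_numE.
have lnE : ln (2 * (v i).2) <= ln rho - 96 * A ^+ 2 / K.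
  have -> : ln rho - 96 * A ^+ 2 / K = ln (rho * expR (- (96 * A ^+ 2 / K))).
    by rewrite lnM ?posrE ?expR_gt0// expRK.
  by rewrite ler_ln ?posrE ?mulr_gt0 ?expR_gt0// ltW.
have fD : K * (96 * A ^+ 2 / K) <= 6 * fine D.
  move: Dge; rewrite DE -EFinM lee_fin => /(le_trans _); apply.
  by rewrite -/rho -/K ler_pM2l//; lra.
have fA : 16 * A ^+ 2 <= fine D.
  by move: fD; rewrite mulrC divfK ?gt_eqF//; lra.
rewrite ler_pdivlMr ?sqrtr_gt0 ?mulr_gt0//.
apply: (@le_trans _ _ (Num.sqrt (16 * A ^+ 2))); last exact: ler_wsqrtr.
rewrite (sqrtrM (A ^+ 2)) ?ler0n// sqrtr_sqr mulrC.
apply: (@le_trans _ _ (Num.sqrt (4 * m) * `|A|)).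
  by rewrite ler_wpM2l ?sqrtr_ge0// ler_norm.
by rewrite ler_wpM2r// ler_wsqrtr//; lra.
Unshelve. all: by end_near. Qed.
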